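(* Let $n\ge 3$, let $\mathcal{P}$ be a finite chiral $n$-polytope of type $\{p_{1},\ldots,p_{n-1}\}$, let $\mathcal{Q}$ be a finite directly regular $n$-polytope of type $\{q_{1},\ldots,q_{n-1}\}$, and suppose $\gcd(p_j,q_j)=1$ for each $j=1,\ldots,n-1$. Then the mix $\Gamma(\mathcal{P})\diamondsuit\Gamma^{+}(\mathcal{Q})$ has the intersection property, so $\mathcal{P}\diamondsuit\mathcal{Q}$ is a chiral or directly regular $n$-polytope of type $\{p_{1}q_{1},\ldots,p_{n-1}q_{n-1}\}$ whose (rotation) group is $\Gamma(\mathcal{P})\times\Gamma^{+}(\mathcal{Q})$. Moreover, if $\mathcal{P}$ is totally chiral and $\Gamma(\mathcal{P})\times\Gamma^{+}(\mathcal{Q})$ has no subgroup which has a quotient isomorphic to $\Gamma(\mathcal{P})\times\Gamma(\mathcal{P})$ (in particular, if $|\Gamma(\mathcal{P})|$ does not divide $|\Gamma^{+}(\mathcal{Q})|$), then $\mathcal{P}\diamondsuit\mathcal{Q}$ is chiral.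
   Context: An abstract $n$-polytope is a ranked poset (ranks $-1,\dots,n$) with a least and a greatest face, all flags of size $n+2$, strongly flag-connected, satisfying the diamond condition; $\Gamma(\mathcal P)$ is its automorphism group. $\mathcal P$ is regular if $\Gamma(\mathcal P)$ is flag-transitive; chiral if $\Gamma(\mathcal P)$ has two flag orbits with adjacent flags in distinct orbits. For regular $\mathcal P$ with generating involutions $\rho_0,\dots,\rho_{n-1}$ (base flag to $i$-adjacent flag), $\Gamma^+(\mathcal P)=\langle\sigma_1,\dots,\sigma_{n-1}\rangle$ with $\sigma_i=\rho_{i-1}\rho_i$; $\mathcal P$ is directly regular if $[\Gamma(\mathcal P):\Gamma^+(\mathcal P)]=2$. For chiral $\mathcal P$, $\Gamma(\mathcal P)$ is generated by the distinguished rotations $\sigma_1,\dots,\sigma_{n-1}$ with respect to a base flag, and $\Gamma^+(\mathcal P):=\Gamma(\mathcal P)$. The type is $\{p_1,\dots,p_{n-1}\}$ with $p_i$ the order of $\sigma_i$. Intersection property for $\Gamma=\langle\sigma_1,\dots,\sigma_{n-1}\rangle$: set $\kappa_{i,j}=\sigma_i\sigma_{i+1}\cdots\sigma_j$ ($1\le i\le j\le n-1$), $\kappa_{0,i}=\kappa_{i,n}=\epsilon$, and for $I\subseteq\{-1,0,\dots,n\}$ let $\Gamma^I=\langle\kappa_{i,j}: i\le j,\ i-1\in I,\ j\in I\rangle$; require $\Gamma^I\cap\Gamma^J=\Gamma^{I\cap J}$ for all $I,J$. A group generated by $\sigma_1,\dots,\sigma_{n-1}$ satisfying $\sigma_i^{p_i}=(\sigma_i\cdots\sigma_j)^2=\epsilon$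 ($i<j$) and the intersection property is the group of a chiral $n$-polytope or the rotation group of a directly regular $n$-polytope with these distinguished generators. Mix: with $\Gamma^+(\mathcal P)=\langle\sigma_j\rangle$, $\Gamma^+(\mathcal Q)=\langle\sigma'_j\rangle$, $\Gamma^+(\mathcal P)\diamondsuit\Gamma^+(\mathcal Q)$ is the subgroup of the direct product generated by $\tau_j=(\sigma_j,\sigma'_j)$; if it has the intersection property w.r.t. the $\tau_j$, the associated polytope is denoted $\mathcal P\diamondsuit\mathcal Q$. Totally chiral: let $W$ be the Coxeter group with generators $r_0,\dots,r_{n-1}$ and relations $r_i^2=(r_ir_j)^2=\epsilon$ for $|i-j|\ge2$, $W^+=\langle s_i=r_{i-1}r_i\rangle$, and $M\trianglelefteq W^+$ with $\Gamma(\mathcal P)=W^+/M$ via $s_i\mapsto\sigma_i$; $\mathcal P$ is totally chiral if $M\,r_0Mr_0^{-1}=W^+$. *)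

(* Defs.v *)
From HB Require Import structures.
From mathcomp Require Import all_boot all_order all_fingroup.
From mathcomp Require Import generic_quotient.
From mathcomp Require boolp.

Set Implicit Arguments.
Unset Strict Implicit.
Unset Printing Implicit Defensive.

Local Open Scope quotient_scope.
Local Open Scope group_scope.

Section Polytopes.
Context {d : Order.disp_t} {T : finTBPOrderType d}.
Implicit Types (x y z : T) (A B Phi Psi : {set T}).

Definition chain A := [forall x in A, forall y in A, (x >=< y)%O].

Definition flag A := maxset chain A.

(* One more than the rank: in an n-polytope [height] runs over 0, .., n.+1,
   the least face (of rank -1) having height 0. *)
Definition height x : nat :=
  \max_(A : {set T} | chain A && [forall y in A, (y < x)%O]) #|A|.

Definition i_adjacent (i : nat) A B :=
  [&& flag A, flag B, A != B &
      [set x in A | height x != i.+1] == [set x in B | height x != i.+1]].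

Definition autgrp := [set f : {perm T} |
  [forall x, forall y, (f x <= f y)%O == (x <= y)%O]].

Lemma autgrp_group_set : group_set autgrp.
Proof.
apply/group_setP; split.
  by rewrite inE; apply/forallP => x; apply/forallP => y; rewrite !perm1.
move=> f g; rewrite !inE => /forallP fP /forallP gP.
apply/forallP => x; apply/forallP => y; rewrite !permM.
by rewrite (eqP (forallP (gP _) _)) (eqP (forallP (fP _) _)).
Qed.
Canonical autgrp_group := Group autgrp_group_set.

Definition flags := [set A | flag A].

End Polytopes.

Arguments autgrp {d} T.
Arguments autgrp_group {d} T.
Arguments flags {d} T.

Section PolytopePredicates.
Variables (n : nat) (d : Order.disp_t) (T : finTBPOrderType d).
Implicit Types (x y z : T) (A B Phi Psi : {set T}).

Definition strongly_flag_connected := forall Phi Psi, flag Phi -> flag Psi ->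
  connect [rel A B : {set T} | [&& Phi :&: Psi \subset A, Phi :&: Psi \subset B &
                         [exists i : 'I_n, i_adjacent i A B]]] Phi Psi.

Definition diamond := forall x y, (x < y)%O -> height y = (height x).+2 ->
  #|[set z | (x < z < y)%O]| = 2.

Definition is_polytope :=
  [/\ forall A : {set T}, flag A -> #|A| = n.+2,
      strongly_flag_connected & diamond].

Definition regular := [transitive autgrp T, on flags T | 'P^*].

Definition chiral :=
  #|orbit 'P^* (autgrp T) @: flags T| = 2 /\
  (forall (i : 'I_n) A B, i_adjacent i A B -> B \notin orbit 'P^* (autgrp T) A).

End PolytopePredicates.

Arguments regular {d} T.

(* Families sigma_1, .., sigma_{n-1} are indexed by nat; only the indices i
   with 0 < i < n matter. *)
Definition rot_group (n : nat) (gT : finGroupType) (s : nat -> gT) : {set gT} :=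
  <<[set s (val i) | i : 'I_n & (0 < i)%N]>>.

Canonical rot_group_group n (gT : finGroupType) (s : nat -> gT) := [group of rot_group n s].

Section Rotations.
Variables (n : nat) (d : Order.disp_t) (T : finTBPOrderType d).
Variable Phi : {set T}.

Definition reflections (rho : nat -> {perm T}) := forall i, (i < n)%N ->
  rho i \in autgrp T /\ i_adjacent i Phi (rho i @: Phi).

Definition rot_of (rho : nat -> {perm T}) (i : nat) : {perm T} :=
  rho i.-1 * rho i.

Definition regular_rotations (s : nat -> {perm T}) :=
  exists2 rho, reflections rho & forall i, (0 < i < n)%N -> s i = rot_of rho i.

(* sigma_i maps the base flag Phi to (Phi^i)^{i-1}, the flag (i-1)-adjacent to
   the one i-adjacent to Phi.  Permutations compose from left to right, so this
   is what rho_{i-1} rho_i does to Phi in the regular case. *)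
Definition chiral_rotations (s : nat -> {perm T}) :=
  forall i, (0 < i < n)%N -> s i \in autgrp T /\
    exists2 Psi, i_adjacent i Phi Psi & i_adjacent i.-1 Psi (s i @: Phi).

End Rotations.

Definition directly_regular n d (T : finTBPOrderType d) :=
  regular T /\ exists (Phi : {set T}) (rho : nat -> {perm T}),
    [/\ flag Phi, reflections n Phi rho &
        #|autgrp T : rot_group n (rot_of rho)| = 2].

Section IntersectionProperty.
Variables (n : nat) (gT : finGroupType) (s : nat -> gT).

Definition kappa (i j : nat) : gT :=
  if (0 < i)%N && (j < n)%N then \prod_(i <= k < j.+1) s k else 1.

(* A set I of ranks in {-1, .., n} is encoded by shifting it by one, so that
   kappa_{i,j} is a generator when i and j + 1 lie in the shifted set. *)
Definition kappa_group (I : {set 'I_n.+2}) : {set gT} :=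
  <<[set kappa (val a) (val b).-1 | a in I, b in I & (a < b)%N]>>.

Definition intersection_property := forall I J : {set 'I_n.+2},
  kappa_group I :&: kappa_group J = kappa_group (I :&: J).

End IntersectionProperty.

Definition mix_gen (gT hT : finGroupType) (s : nat -> gT) (t : nat -> hT)
  (i : nat) : gT * hT := (s i, t i).

Definition mix n (gT hT : finGroupType) (s : nat -> gT) (t : nat -> hT) :=
  rot_group n (mix_gen s t).

Definition isom_on_gens n (gT hT : finGroupType) (G : {set gT})
    (s : nat -> gT) (t : nat -> hT) :=
  exists2 f : {morphism G >-> hT}, isom G (rot_group n t) f &
    forall i, (0 < i < n)%N -> f (s i) = t i.

(* R is the chiral or directly regular n-polytope associated with the group
   generated by t_1, .., t_{n-1}: with respect to the base flag Omega, its
   distinguished rotations u_i correspond to the t_i. *)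
Definition polytope_of n (gT : finGroupType) (t : nat -> gT)
    d (R : finTBPOrderType d) (Omega : {set R}) (u : nat -> {perm R}) :=
  [/\ is_polytope n R, flag Omega &
      [/\ chiral n R, chiral_rotations n Omega u &
          isom_on_gens n (autgrp R) u t] \/
      [/\ directly_regular n R, regular_rotations n Omega u &
          isom_on_gens n (rot_group n u) u t]].

Definition no_subgroup_with_quotient (gT hT : finGroupType)
    (G : {set gT}) (K : {set hT}) :=
  forall H N : {group gT}, H \subset G -> N <| H -> ~ (H / N \isog K).

Inductive gen_by (G : groupType) (S : G -> Prop) : G -> Prop :=
| gen_by_in x of S x : gen_by S x
| gen_by_1 : gen_by S 1
| gen_by_M x y of gen_by S x & gen_by S y : gen_by S (x * y)
| gen_by_V x of gen_by S x : gen_by S x^-1.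

Section Coxeter.
Variable n : nat.
Implicit Types (u v w : seq 'I_n) (i j : 'I_n).

(* The r_i being involutions, words without inverses suffice, and inversion is
   reversal. *)
Inductive cox_eq : seq 'I_n -> seq 'I_n -> Prop :=
| cox_refl u : cox_eq u u
| cox_sym u v of cox_eq u v : cox_eq v u
| cox_trans u v w of cox_eq u v & cox_eq v w : cox_eq u w
| cox_sq u v i : cox_eq (u ++ [:: i; i] ++ v) (u ++ v)
| cox_comm u v i j of (i.+1 < j)%N || (j.+1 < i)%N :
    cox_eq (u ++ [:: i; j; i; j] ++ v) (u ++ v).

Definition cox_rel u v := boolp.asbool (cox_eq u v).

Lemma cox_rel_is_equiv : equiv_class_of cox_rel.
Proof.
split=> [u | u v | v u w].
- by apply/boolp.asboolP; apply: cox_refl.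
- by apply/boolp.asboolP/boolp.asboolP; apply: cox_sym.
- by move=> /boolp.asboolP uv /boolp.asboolP vw; apply/boolp.asboolP;
    apply: cox_trans vw.
Qed.

Canonical cox_equiv := EquivRelPack cox_rel_is_equiv.

Definition cox := {eq_quot cox_equiv}.
HB.instance Definition _ := Choice.on cox.
HB.instance Definition _ := Quotient.on cox.

Definition cox_word (u : seq 'I_n) : cox := \pi_cox u.

Lemma cox_wordP u v : reflect (cox_word u = cox_word v) (cox_rel u v).
Proof. exact: (@eqmodP _ cox_equiv u v). Qed.

Lemma cox_eq_catl w u v : cox_eq u v -> cox_eq (w ++ u) (w ++ v).
Proof.
elim=> [u1|u1 v1 _|u1 v1 w1 _ IH1 _|u1 v1 i|u1 v1 i j ij].
- exact: cox_refl.
- exact: cox_sym.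
- exact: cox_trans.
- by rewrite [in X in cox_eq X]catA [X in cox_eq _ X]catA; apply: cox_sq.
- by rewrite [in X in cox_eq X]catA [X in cox_eq _ X]catA; apply: cox_comm.
Qed.

Lemma cox_eq_catr w u v : cox_eq u v -> cox_eq (u ++ w) (v ++ w).
Proof.
elim=> [u1|u1 v1 _|u1 v1 w1 _ IH1 _|u1 v1 i|u1 v1 i j ij].
- exact: cox_refl.
- exact: cox_sym.
- exact: cox_trans.
- by rewrite -!catA; apply: cox_sq.
- by rewrite -!catA; apply: cox_comm.
Qed.

Lemma cox_eq_rev u v : cox_eq u v -> cox_eq (rev u) (rev v).
Proof.
elim=> [u1|u1 v1 _|u1 v1 w1 _ IH1 _|u1 v1 i|u1 v1 i j ij].
- exact: cox_refl.
- exact: cox_sym.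
- exact: cox_trans.
- by rewrite !rev_cat -!catA; apply: cox_sq.
- by rewrite !rev_cat -!catA; apply: cox_comm; rewrite orbC.
Qed.

Lemma cox_eq_revK u : cox_eq (rev u ++ u) [::].
Proof.
elim: u => [|i u IHu]; first exact: cox_refl.
rewrite rev_cons -cats1 -catA; apply: cox_trans IHu.
exact: (cox_sq (rev u) u i).
Qed.

Definition cox_mul (x y : cox) : cox := cox_word (repr x ++ repr y).
Definition cox_inv (x : cox) : cox := cox_word (rev (repr x)).

Lemma cox_reprK x : cox_word (repr x) = x.
Proof. exact: reprK. Qed.

Lemma cox_repr u : cox_eq (repr (cox_word u)) u.
Proof. exact/boolp.asboolP/cox_wordP/cox_reprK. Qed.

Lemma cox_word_eq u v : cox_eq u v -> cox_word u = cox_word v.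
Proof. by move=> uv; apply/cox_wordP/boolp.asboolP. Qed.

Lemma cox_wordM u v : cox_mul (cox_word u) (cox_word v) = cox_word (u ++ v).
Proof.
apply: cox_word_eq; apply: (@cox_trans _ (u ++ repr (cox_word v))).
  exact/cox_eq_catr/cox_repr.
exact/cox_eq_catl/cox_repr.
Qed.

Lemma cox_wordV u : cox_inv (cox_word u) = cox_word (rev u).
Proof. exact/cox_word_eq/cox_eq_rev/cox_repr. Qed.

Lemma cox_mulA : associative cox_mul.
Proof.
move=> x y z; rewrite -(cox_reprK x) -(cox_reprK y) -(cox_reprK z).
by rewrite !cox_wordM catA.
Qed.

Lemma cox_mul1 : left_id (cox_word [::]) cox_mul.
Proof. by move=> x; rewrite -(cox_reprK x) cox_wordM. Qed.

Lemma cox_mulr1 : right_id (cox_word [::]) cox_mul.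
Proof. by move=> x; rewrite -(cox_reprK x) cox_wordM cats0. Qed.

Lemma cox_mulV : left_inverse (cox_word [::]) cox_inv cox_mul.
Proof.
move=> x; rewrite -(cox_reprK x) cox_wordV cox_wordM.
exact/cox_word_eq/cox_eq_revK.
Qed.

Lemma cox_mulrV : right_inverse (cox_word [::]) cox_inv cox_mul.
Proof.
move=> x; rewrite -(cox_reprK x) cox_wordV cox_wordM.
by apply/cox_word_eq; rewrite -{1}[repr x]revK; apply/cox_eq_revK.
Qed.

HB.instance Definition _ :=
  isGroup.Build cox cox_mulA cox_mul1 cox_mulr1 cox_mulV cox_mulrV.

(* Only the indices i < n matter. *)
Definition cox_r (i : nat) : cox :=
  if insub i is Some k then cox_word [:: k] else 1.

Definition cox_s (i : nat) : cox := cox_r i.-1 * cox_r i.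

Definition cox_plus : cox -> Prop :=
  gen_by (fun x : cox => exists2 i, (0 < i < n)%N & x = cox_s i).

End Coxeter.

(* M is the kernel of the epimorphism W^+ -> Gamma(P), s_i |-> sigma_i, so that
   W^+ / M = Gamma(P); only the restriction of phi to W^+ matters. *)
Definition totally_chiral n (gT : finGroupType) (s : nat -> gT) :=
  exists phi : cox n -> gT,
    [/\ forall x y, cox_plus x -> cox_plus y -> phi (x * y) = phi x * phi y,
        forall i, (0 < i < n)%N -> phi (cox_s n i) = s i &
        let M w := cox_plus w /\ phi w = 1 in
        forall w : cox n, cox_plus w <->
          exists m m', [/\ M m, M m' &
                           w = m * (cox_r n 0 * m' * (cox_r n 0)^-1)]].

(* Main.v *)
Require Import Defs.
From HB Require Import structures.
From mathcomp Require Import all_boot all_order all_fingroup cyclic zify.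

Set Implicit Arguments.
Unset Strict Implicit.
Unset Printing Implicit Defensive.

Import Order.POrderTheory.

Local Open Scope group_scope.

(** Everything is read off flag graphs.  Let X be the set of pairs (A, B) of
    flags of P and Q of the same colour, where the colours are the two orbits
    of the rotation group, and let i-adjacency act on both coordinates at once.
    Since p_j and q_j are coprime, a power of the rotation (r_{j-1} r_j) moves B
    one step while fixing A; hence a walk with letters in I can move the two
    coordinates independently, subject only to the condition that, for each
    rank k outside I, both use letters below k with the same parity.  These
    parities are well defined on the flags through the face of rank k, so two
    flags of X linked by an I-walk and by a J-walk are linked by a walk with
    letters in the intersection of I and J.  Through the orbit map
    g |-> base flag . g this is the intersection property of the mix.  The same
    path-intersection property makes the orbits of the walks avoiding one letter
    the faces of an n-polytope R with flag set X, on which the mix acts with the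
    two colour classes as orbits; R is directly regular or chiral according to
    whether some automorphism exchanges the colours.

    If R were directly regular, conjugation by rho_0 would turn the projection
    onto Gamma(P) into g |-> (pr g, pr (g ^ rho_0)), which total chirality
    makes onto Gamma(P) x Gamma(P). *)

(** * Walks along involutive labelled steps, and the parities they determine *)

Section Walks.
Variables (n : nat) (X : finType) (r : 'I_n -> X -> X).
Implicit Types (I J : pred 'I_n) (w : seq 'I_n) (x y : X).

Definition walk w x := foldr r x w.

Definition linked I x y :=
  connect [rel x y | [exists i, I i && (r i x == y)]] x y.

(** The intersection property carried over from subgroups to walks: sets of letters replace sets of
    ranks, and pairs of endpoints replace group elements. *)
Definition path_intersection := forall I J x y,
  linked I x y -> linked J x y -> linked (predI I J) x y.

Lemma walk_cat w1 w2 x : walk (w1 ++ w2) x = walk w1 (walk w2 x).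
Proof. exact: foldr_cat. Qed.

Lemma linkedP I x y :
  reflect (exists2 w, all I w & walk w x = y) (linked I x y).
Proof.
apply: (iffP connectP) => [[p px ->] | [w Iw <-]].
  elim: p x px => [|z p IHp] x /=; first by exists [::].
  case/andP => /existsP[i /andP[Ii /eqP <-]] /IHp[w Iw w_last].
  exists (rcons w i); first by rewrite all_rcons Ii.
  by rewrite -cats1 walk_cat.
elim: w Iw => [|i w IHw] /=; first by exists [::].
case/andP => Ii /IHw[p px p_last]; exists (rcons p (r i (walk w x))).
  by rewrite rcons_path px /= -p_last; apply/existsP; exists i; rewrite Ii /=.
by rewrite last_rcons.
Qed.

Lemma linked_refl I x : linked I x x.
Proof. exact: connect0. Qed.

Lemma linked_trans I : transitive (linked I).
Proof. by move=> y x z; apply: connect_trans. Qed.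

Lemma linked_sub I J x y : subpred I J -> linked I x y -> linked J x y.
Proof.
by move=> sIJ /linkedP[w Iw <-]; apply/linkedP; exists w; first exact: sub_all Iw.
Qed.

Lemma linked_walk I w x : all I w -> linked I x (walk w x).
Proof. by move=> Iw; apply/linkedP; exists w. Qed.

Lemma linked_none I x y : I =1 pred0 -> linked I x y -> x = y.
Proof.
by move=> I0 /linkedP[[|i w] /=]; first by []; rewrite I0.
Qed.

Hypothesis rK : forall i, involutive (r i).

Lemma walk_revK w : cancel (walk w) (walk (rev w)).
Proof.
elim: w => [|i w IHw] x //=.
by rewrite rev_cons -cats1 walk_cat /= rK IHw.
Qed.

Lemma walk_revKV w : cancel (walk (rev w)) (walk w).
Proof. by move=> x; have := walk_revK (rev w) x; rewrite revK. Qed.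

Lemma linked_sym I x y : linked I x y -> linked I y x.
Proof.
case/linkedP=> w Iw <-; apply/linkedP; exists (rev w); first by rewrite all_rev.
exact: walk_revK.
Qed.

Section FarCommutation.
Hypothesis rC : forall (i j : 'I_n) x, (i.+1 < j)%N -> r i (r j x) = r j (r i x).

Lemma walk_far (i : 'I_n) w x : all (fun j : 'I_n => (i.+1 < j) || (j.+1 < i))%N w ->
  r i (walk w x) = walk w (r i x).
Proof.
elim: w => //= j w IHw /andP[ij /IHw <-].
by case/orP: ij => /rC ->.
Qed.

(** Letter [i] changes the face of rank [i], which has height [i.+1]. So [off h] collects the
    letters that leave the face of height [h] alone, and [below h], [above h] those that act
    strictly under or strictly over it. *)
Definition below (h : nat) : pred 'I_n := fun i => (i.+1 < h)%N.
Definition above (h : nat) : pred 'I_n := fun i => (h <= i)%N.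
Definition off (h : nat) : pred 'I_n := fun i => i.+1 != h.

(** A letter below [h] and a letter above it differ by at least two, so the two kinds commute and
    the walk can be sorted. *)
Lemma walk_split_above h w x : all (off h) w ->
  walk w x = walk (filter (above h) w) (walk (filter (below h) w) x).
Proof.
elim: w => //= i w IHw /andP[ih /IHw ->]; rewrite /below /above.
case: (leqP h i) => ih1 /=.
  by have -> : (i.+1 < h)%N = false by lia.
have ih2 : (i.+1 < h)%N by rewrite /off in ih; lia.
rewrite ih2 /=.
by apply: walk_far; apply/allP => j; rewrite mem_filter => /andP[]; rewrite /= => jh _; lia.
Qed.

Section Colour.
Variable c : X -> bool.
Hypothesis cr : forall i x, c (r i x) = ~~ c x.

Lemma colour_walk w x : c (walk w x) = odd (size w) (+) c x.
Proof. by elim: w => //= i w IHw; rewrite cr IHw addNb. Qed.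

Hypothesis r_int : path_intersection.

(** The lower parts of the two walks end at flags that are linked by letters below [h] and also by
    letters above it, hence equal; the colour of this common flag fixes the parity. *)
Lemma walk_parity h w z x : all (off h) w -> all (off h) z ->
  walk w x = walk z x ->
  odd (count (below h) w) = odd (count (below h) z).
Proof.
move=> hw hz; rewrite (walk_split_above x hw) (walk_split_above x hz).
set a := filter (below h) w; set b := filter (above h) w.
set a' := filter (below h) z; set b' := filter (above h) z => eq_wz.
have Ea : walk a x = walk a' x.
  apply: (@linked_none (predI (below h) (above h))).
    by move=> i; rewrite /= /below /above; lia.
  apply: r_int; apply/linkedP.
    exists (a' ++ rev a); last by rewrite walk_cat walk_revK.
    by rewrite all_cat all_rev !filter_all.
  exists (rev b' ++ b); last by rewrite walk_cat eq_wz walk_revK.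
  by rewrite all_cat all_rev !filter_all.
have := congr1 c Ea; rewrite !colour_walk !size_filter.
by move/addIb.
Qed.

End Colour.
End FarCommutation.
End Walks.

(** * Mixing two flag graphs with coprime rotations *)

Section MixWalks.
Variables (n : nat) (X Y : finType) (r : 'I_n -> X -> X) (r' : 'I_n -> Y -> Y).
Hypothesis rK : forall i, involutive (r i).
Hypothesis r'K : forall i, involutive (r' i).
Hypothesis r'C : forall (i j : 'I_n) x, (i.+1 < j)%N -> r' i (r' j x) = r' j (r' i x).
Hypothesis r_coprime : forall i j : 'I_n, i.+1 = j -> exists m,
  (forall x, iter m (fun x => r i (r j x)) x = x) /\
  (forall y, iter m (fun y => r' i (r' j y)) y = r' i (r' j y)).
Variable I : pred 'I_n.

(* The moves of the second coordinate that an I-walk can perform while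
   bringing the first coordinate back to its starting point. *)
Definition free_move (f : Y -> Y) := forall x y,
  exists w, [/\ all I w, walk r w x = x & walk r' w y = f y].

Lemma eq_free_move f g : f =1 g -> free_move f -> free_move g.
Proof.
by move=> fg Ef x y; have [w [Iw wx wy]] := Ef x y; exists w; rewrite -fg.
Qed.

Lemma free_move_id : free_move id.
Proof. by move=> x y; exists [::]. Qed.

Lemma free_move_comp f g : free_move f -> free_move g -> free_move (f \o g).
Proof.
move=> Ef Eg x y; have [w [Iw wx wy]] := Eg x y.
have [w' [Iw' wx' wy']] := Ef x (g y).
by exists (w' ++ w); rewrite all_cat Iw Iw' !walk_cat wx wy.
Qed.

(** The word of a free move may depend on the starting pair, so it is taken at the pair reached by
    [rev a]; the final [a] then restores the first coordinate. *)
Lemma free_move_conj a f : all I a -> free_move f ->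
  free_move (fun y => walk r' a (f (walk r' (rev a) y))).
Proof.
move=> Ia Ef x y.
have [w [Iw wx wy]] := Ef (walk r (rev a) x) (walk r' (rev a) y).
exists (a ++ w ++ rev a); rewrite !all_cat all_rev Ia Iw !walk_cat wx wy.
by rewrite walk_revKV.
Qed.

Lemma free_move_sym (i j : 'I_n) : I j ->
  free_move (r' i \o r' j) -> free_move (r' j \o r' i).
Proof.
move=> Ij /(@free_move_conj [:: j]); rewrite /= Ij => /(_ isT).
by apply: eq_free_move => y /=; rewrite r'K.
Qed.

(** The word repeats [i; j] as often as the exponent [m] of [r_coprime] says: a full turn on [X], a
    single step on [Y]. *)
Lemma free_move_succ (i j : 'I_n) : I i -> I j -> i.+1 = j ->
  free_move (r' i \o r' j).
Proof.
move=> Ii Ij /r_coprime[m [mx my]] x y; exists (flatten (nseq m [:: i; j])).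
have walkE (Z : finType) (q : 'I_n -> Z -> Z) z :
    walk q (flatten (nseq m [:: i; j])) z = iter m (fun z => q i (q j z)) z.
  by elim: m {mx my} => //= m ->.
rewrite !walkE mx my; split=> //.
by elim: m {mx my walkE} => //= m ->; rewrite Ii Ij.
Qed.

Definition out (k : nat) := if insub k is Some i then ~~ I i else true.

(* Two letters of I carry the same label when no letter outside I separates
   them. *)
Definition label (k : nat) := count out (iota 0 k).

Lemma out_ord (i : 'I_n) : out i = ~~ I i.
Proof. by rewrite /out valK. Qed.

Lemma labelS k : label k.+1 = (label k + out k)%N.
Proof. by rewrite /label -addn1 iotaD count_cat /= addn0. Qed.

Lemma label_mono k l : (k <= l)%N -> (label k <= label l)%N.
Proof.
elim: l => [|l IHl]; first by rewrite leqn0 => /eqP->.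
rewrite leq_eqVlt ltnS => /predU1P[-> // | /IHl].
by rewrite labelS; lia.
Qed.

(** Equal labels mean that every letter between [i] and [j] lies in [I], so the move telescopes into
    moves by consecutive letters. *)
Lemma free_move_label (i j : 'I_n) : I i -> I j -> label i = label j ->
  free_move (r' i \o r' j).
Proof.
wlog le_ij : i j / (i <= j)%N => [IH Ii Ij lij|].
  have [/IH|/ltnW/IH IHji] := leqP i j; first exact.
  exact/free_move_sym/IHji.
move: {2}(j - i) (erefl (j - i)) => d.
elim: d j le_ij => [|d IHd] j le_ij dij Ii Ij lij.
  have -> : j = i by apply: val_inj => /=; lia.
  apply: eq_free_move free_move_id => y /=; by rewrite r'K.
have j'P : (j.-1 < n)%N by have := ltn_ord j; lia.
pose j' := Ordinal j'P; have jS : j = j'.+1 :> nat by rewrite /=; lia.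
have lij' : (label i <= label j')%N by apply: label_mono; rewrite /=; lia.
have := labelS j'; rewrite -jS -lij out_ord => lj.
have Ij' : I j' by apply: contraLR lij' => /negbTE Ij'; rewrite Ij' in lj; lia.
rewrite Ij' addn0 in lj.
apply: (@eq_free_move ((r' i \o r' j') \o (r' j' \o r' j))).
  by move=> y /=; rewrite r'K.
apply: free_move_comp; last exact: free_move_succ.
by apply: IHd => //=; lia.
Qed.

(** Let [j] be the next letter with the label of the first letter [i]. The walk [i a j b] is the
    conjugate by [a] of the free move [i j], composed with the shorter walk [a b], in which that
    label occurs twice less. *)
Lemma free_move_walk u : all I u ->
  (forall m, ~~ odd (count (fun i : 'I_n => label i == m) u)) ->
  free_move (walk r' u).
Proof.
have [N] := ubnP (size u); elim: N u => // N IHN [|i u] /= leN.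
  by move=> _ _; apply: free_move_id.
case/andP=> Ii Iu even_u.
have has_u : has (fun j : 'I_n => label j == label i) u.
  by have := even_u (label i); rewrite eqxx has_count; lia.
case: (split_find has_u) Iu even_u leN => j a b /eqP lji a_i.
rewrite -cats1 -catA all_cat /= => /and3P[Ia Ij Ib] even_u.
rewrite size_cat /= => leN.
apply: (@eq_free_move
  ((fun y => walk r' a (r' i (r' j (walk r' (rev a) y)))) \o walk r' (a ++ b))).
  move=> y /=; rewrite walk_cat walk_revK // [walk r' (_ ++ _) _]walk_cat /=.
  rewrite -walk_far // {b even_u Ib y leN}.
  (* The letter [i] commutes with [a]: a letter of [I] equal or adjacent to [i] would carry the
     label of [i], and [a] contains none. *)
  apply/allP=> k ka; have /hasPn/(_ k ka) lki := a_i.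
  have Ik : I k by apply: (allP Ia).
  have := labelS i; have := labelS k; rewrite !out_ord Ii Ik !addn0 => lk li.
  apply: contraR lki => far_ik.
  have [ik|ik|->] := ltngtP i k; last by [].
    have -> : k = i.+1 :> nat by lia.
    by rewrite li.
  have -> : i = k.+1 :> nat by lia.
  by rewrite lk.
apply: free_move_comp.
  exact: (free_move_conj Ia (free_move_label Ii Ij (esym lji))).
apply: IHN; first by rewrite size_cat; lia.
  by rewrite all_cat Ia.
move=> m; have := even_u m; rewrite !count_cat /= lji.
by case: (label i == m) => /=; lia.
Qed.

(** The letters outside [I] cut [I] into its label classes. The numbers of letters below each cut,
    and the total number, are even; their differences are the numbers per class. *)
Lemma even_labels u : all I u -> ~~ odd (size u) ->
  (forall k : 'I_n, ~~ I k -> ~~ odd (count (below k.+1) u)) ->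
  forall m, ~~ odd (count (fun i : 'I_n => label i == m) u).
Proof.
move=> Iu even_u evenI.
have even_lt k : (k <= n)%N -> forall m, (m <= label k)%N ->
    ~~ odd (count (fun i : 'I_n => label i < m)%N u).
  elim: k => [|k IHk] lekn m.
    by rewrite leqn0 => /eqP->; rewrite (@eq_count _ _ pred0) // count_pred0.
  rewrite labelS => le_m.
  have [/IHk->//|lt_m] := leqP m (label k); first exact: ltnW.
  have outk : out k by case: (out k) le_m => //; lia.
  have Em : m = (label k).+1 by rewrite outk in le_m; lia.
  have Ik : ~~ I (Ordinal lekn) by rewrite -out_ord.
  have := evenI _ Ik; congr (~~ odd _); apply: eq_in_count => i iu.
  have Ii : I i by apply: (allP Iu).
  (* For [i] in [I] and the cut [k] outside it, having at most the label of [k] amounts to lying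
     below [k]. *)
  rewrite /below Em !ltnS /=.
  have [ik|ki|Eik] := ltngtP i k.
  - by rewrite label_mono // ltnW.
  - by have := label_mono ki; rewrite labelS outk; lia.
  - have Ei : i = Ordinal lekn by apply: val_inj.
    by rewrite -Ei Ii in Ik.
have even_all m : ~~ odd (count (fun i : 'I_n => label i < m)%N u).
  have [/even_lt->//|lt_m] := leqP m (label n).
  rewrite (_ : count _ u = size u) //; apply/eqP; rewrite -all_count.
  apply/allP=> i _; apply: leq_ltn_trans lt_m.
  by apply: label_mono; apply: ltnW.
move=> m; have := even_all m.+1.
rewrite (_ : count _ u = count (fun i : 'I_n => label i < m)%N u +
                         count (fun i : 'I_n => label i == m) u)%N.
  by rewrite oddD (negbTE (even_all m)).
rewrite -count_predUI [X in (_ + X)%N](@eq_count _ _ pred0) => [|i /=].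
  rewrite count_pred0 addn0; apply: eq_count => i /=.
  by rewrite ltnS leq_eqVlt orbC.
by lia.
Qed.

End MixWalks.

(** * Connectedness and path intersection of the mixed flag graph *)

Section MixIntersection.
Variables (n : nat) (X Y : finType) (r : 'I_n -> X -> X) (r' : 'I_n -> Y -> Y).
Hypothesis rK : forall i, involutive (r i).
Hypothesis r'K : forall i, involutive (r' i).
Hypothesis rC : forall (i j : 'I_n) x, (i.+1 < j)%N -> r i (r j x) = r j (r i x).
Hypothesis r'C : forall (i j : 'I_n) x, (i.+1 < j)%N -> r' i (r' j x) = r' j (r' i x).
Hypothesis r_coprime : forall i j : 'I_n, i.+1 = j -> exists m,
  (forall x, iter m (fun x => r i (r j x)) x = x) /\
  (forall y, iter m (fun y => r' i (r' j y)) y = r' i (r' j y)).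

(** Following [z] in both coordinates leaves only the second one to be corrected, by the word
    [z' ++ rev z]; the parity hypotheses make this a free move. *)
Lemma mix_walk (I : pred 'I_n) z z' x y : all I z -> all I z' ->
    odd (size z) = odd (size z') ->
    (forall k : 'I_n, ~~ I k ->
       odd (count (below k.+1) z) = odd (count (below k.+1) z')) ->
  exists2 w, all I w & walk r w x = walk r z x /\ walk r' w y = walk r' z' y.
Proof.
move=> Iz Iz' size_zz' count_zz'.
have Iu : all I (z' ++ rev z) by rewrite all_cat all_rev Iz Iz'.
have := @free_move_walk n X Y r r' rK r'K r'C r_coprime I _ Iu.
case/(_ _ (walk r z x) (walk r' z y)) => [|w [Iw wx wy]].
  apply: even_labels => //.
    by rewrite size_cat size_rev oddD size_zz' addbb.
  by move=> k /count_zz'; rewrite count_cat count_rev oddD => ->; rewrite addbb.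
exists (w ++ z); first by rewrite all_cat Iw.
by rewrite !walk_cat wx wy walk_cat walk_revK.
Qed.

Variables (c : X -> bool) (c' : Y -> bool).
Hypothesis cr : forall i x, c (r i x) = ~~ c x.
Hypothesis c'r : forall i x, c' (r' i x) = ~~ c' x.

Definition mix_type := {xy : X * Y | c xy.1 == c' xy.2}.

Fact mix_step_subproof i (xy : mix_type) :
  c (r i (val xy).1) == c' (r' i (val xy).2).
Proof. by rewrite cr c'r (eqP (valP xy)). Qed.

Definition mix_step i (xy : mix_type) : mix_type :=
  exist _ (r i (val xy).1, r' i (val xy).2) (mix_step_subproof i xy).

Lemma val_mix_walk w xy : val (walk mix_step w xy) =
  (walk r w (val xy).1, walk r' w (val xy).2).
Proof. by elim: w => [|i w /= ->] //=; case: (val xy). Qed.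

Lemma mix_stepK i : involutive (mix_step i).
Proof. by move=> xy; apply: val_inj; rewrite /= rK r'K; case: (val xy). Qed.

Lemma mix_stepC (i j : 'I_n) xy : (i.+1 < j)%N ->
  mix_step i (mix_step j xy) = mix_step j (mix_step i xy).
Proof. by move=> ij; apply: val_inj; rewrite /= rC // r'C. Qed.

(** The lengths of [z] and [z'] have the same parity because the coordinates have equal colours at
    both ends, so [mix_walk] applies. *)
Lemma mix_linked (I : pred 'I_n) (xy uv : mix_type) z z' :
    all I z -> all I z' ->
    walk r z (val xy).1 = (val uv).1 -> walk r' z' (val xy).2 = (val uv).2 ->
    (forall k : 'I_n, ~~ I k ->
       odd (count (below k.+1) z) = odd (count (below k.+1) z')) ->
  linked mix_step I xy uv.
Proof.
move=> Iz Iz' zE z'E zz'.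
have [|w Iw [wz wz']] := mix_walk (val xy).1 (val xy).2 Iz Iz' _ zz'.
  have := eqP (valP uv); rewrite /= -zE -z'E (colour_walk cr) (colour_walk c'r).
  by rewrite (eqP (valP xy)) => /addIb.
apply/linkedP; exists w => //; apply: val_inj.
by rewrite val_mix_walk wz wz' zE z'E; case: (val uv).
Qed.

Hypothesis r_conn : forall x y, linked r predT x y.
Hypothesis r'_conn : forall x y, linked r' predT x y.

Lemma mix_connected xy uv : linked mix_step predT xy uv.
Proof.
have /linkedP[z _ zE] := r_conn (val xy).1 (val uv).1.
have /linkedP[z' _ z'E] := r'_conn (val xy).2 (val uv).2.
by apply: (@mix_linked _ _ _ z z') => //; apply/allP.
Qed.

Hypothesis r_int : path_intersection r.
Hypothesis r'_int : path_intersection r'.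

(** Path intersection in each coordinate gives words [z] and [z'] in the common letters, whose
    parities below each missing letter [k] must be compared. One of the given walks [w], [w'] avoids
    [k] and moves both coordinates at once, so [walk_parity] matches [z] and [z'] with it. *)
Lemma mix_path_intersection : path_intersection mix_step.
Proof.
move=> I J xy uv /linkedP[w Iw wE] /linkedP[w' Jw' w'E].
have [wx wy] : walk r w (val xy).1 = (val uv).1 /\
               walk r' w (val xy).2 = (val uv).2 by rewrite -wE val_mix_walk.
have [w'x w'y] : walk r w' (val xy).1 = (val uv).1 /\
               walk r' w' (val xy).2 = (val uv).2 by rewrite -w'E val_mix_walk.
have /linkedP[z IJz zE] : linked r (predI I J) (val xy).1 (val uv).1.
  by apply: r_int; apply/linkedP; [exists w | exists w'].
have /linkedP[z' IJz' z'E] : linked r' (predI I J) (val xy).2 (val uv).2.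
  by apply: r'_int; apply/linkedP; [exists w | exists w'].
apply: (mix_linked IJz IJz') => // k IJk.
have off_k (K : pred 'I_n) v : ~~ K k -> all K v -> all (off k.+1) v.
  move=> Kk /allP Kv; apply/allP => l /Kv Kl; rewrite /off eqSS.
  by apply: contraNneq Kk => /val_inj <-.
have zoff := off_k _ _ IJk IJz; have z'off := off_k _ _ IJk IJz'.
have parity v : all (off k.+1) v -> walk r v (val xy).1 = (val uv).1 ->
    walk r' v (val xy).2 = (val uv).2 ->
    odd (count (below k.+1) z) = odd (count (below k.+1) z').
  move=> voff vx vy.
  have zv : walk r z (val xy).1 = walk r v (val xy).1 by rewrite zE.
  have z'v : walk r' z' (val xy).2 = walk r' v (val xy).2 by rewrite z'E.
  rewrite (walk_parity rK rC cr r_int zoff voff zv).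
  by rewrite (walk_parity r'K r'C c'r r'_int z'off voff z'v).
move: IJk; rewrite /= negb_and => /orP[Ik|Jk].
  exact: parity (off_k _ _ Ik Iw) _ _.
exact: parity (off_k _ _ Jk Jw') _ _.
Qed.

End MixIntersection.

(** * Flags of a ranked poset *)

Section RankedPoset.
Variables (n : nat) (d : Order.disp_t) (T : finTBPOrderType d).
Hypothesis flag_size : forall A : {set T}, flag A -> #|A| = n.+2.
Implicit Types (x y z : T) (A B : {set T}).

Lemma chainP A : reflect {in A &, forall x y, (x >=< y)%O} (chain A).
Proof.
apply: (iffP forall_inP) => chA x => [y xA yA | xA].
  exact: (forall_inP (chA x xA)).
by apply/forall_inP => y; apply: chA.
Qed.

Lemma chain_sub A B : A \subset B -> chain B -> chain A.
Proof.
move=> /subsetP sAB /chainP chB; apply/chainP => x y /sAB xB /sAB yB.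
exact: chB.
Qed.

Lemma flag_chain A : flag A -> chain A.
Proof. exact: maxsetp. Qed.

Lemma chain_flag A : chain A -> exists2 B, flag B & A \subset B.
Proof. by move=> /(@maxset_exists _ _ _)[B flB sAB]; exists B. Qed.

Lemma chain1 x : chain [set x].
Proof. by apply/chainP => y z /set1P-> /set1P->; exact: comparablexx. Qed.

Lemma mem_flag x : exists2 A, flag A & x \in A.
Proof. by have [A flA] := chain_flag (chain1 x); rewrite sub1set => xA; exists A. Qed.

Lemma flag_card A : flag A = chain A && (#|A| == n.+2).
Proof.
apply/idP/andP => [flA | [/chain_flag[B flB sAB] /eqP cardA]].
  by rewrite flag_chain // flag_size.
suff -> : A = B by [].
by apply/eqP; rewrite eqEcard sAB cardA flag_size ?leqnn.
Qed.

(** A chain below [x] together with the part of [A] from [x] upwards extends to a flag. As all flags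
    have the same size, that chain has no more elements than the part of [A] below [x]. *)
Lemma height_flag A x : flag A -> x \in A ->
  height x = #|[set y in A | (y < x)%O]|.
Proof.
move=> flA xA; have /chainP chA := flag_chain flA.
apply/eqP; rewrite eqn_leq; apply/andP; split; last first.
  apply: (bigmax_sup [set y in A | (y < x)%O]) => //; apply/andP; split.
    by apply: chain_sub (flag_chain flA); apply/subsetP=> y; rewrite inE => /andP[].
  by apply/forall_inP => y; rewrite inE => /andP[].
apply/bigmax_leqP => C /andP[/chainP chC /forall_inP Cx].
pose D := [set y in A | (x <= y)%O].
have chCD : chain (C :|: D).
  apply/chainP => y z /setUP[yC | /setIdP[yA xy]] /setUP[zC | /setIdP[zA xz]].
  - exact: chC.
  - by apply: le_comparable; apply: le_trans (ltW (Cx _ yC)) xz.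
  - by apply: ge_comparable; apply: le_trans (ltW (Cx _ zC)) xy.
  - exact: chA.
have [B flB sCDB] := chain_flag chCD.
have := subset_leq_card sCDB; rewrite (flag_size flB) -(flag_size flA).
have CD0 : C :&: D = set0.
  apply/setP => y; rewrite !inE; apply/negbTE/negP => /and3P[yC _ xy].
  by have := lt_le_trans (Cx _ yC) xy; rewrite ltxx.
rewrite cardsU CD0 cards0 subn0 -(cardsID [set y | (y < x)%O] A).
have -> : A :&: [set y | (y < x)%O] = [set y in A | (y < x)%O].
  by apply/setP=> y; rewrite !inE.
suff -> : A :\: [set y | (y < x)%O] = D by rewrite leq_add2r.
apply/setP=> y; rewrite !inE andbC; case yA: (y \in A) => //=.
by rewrite -(comparable_leNgt (chA _ _ xA yA)).
Qed.

Lemma height_lt x y : (x < y)%O -> (height x < height y)%N.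
Proof.
move=> xy; have [] := @chain_flag [set x; y].
  apply/chainP => u v /set2P[]-> /set2P[]->; rewrite ?comparablexx //.
    exact/le_comparable/ltW.
  exact/ge_comparable/ltW.
move=> A flA; rewrite subUset !sub1set => /andP[xA yA].
rewrite !(height_flag flA) //; apply/proper_card/properP; split.
  apply/subsetP=> z; rewrite !inE => /andP[-> /=] zx; exact: lt_trans xy.
by exists x; rewrite !inE xA ?xy // ltxx.
Qed.

Lemma height_inj A : chain A -> {in A &, injective (@height d T)}.
Proof.
move=> /chainP chA x y xA yA Exy; apply/eqP.
have := chA _ _ xA yA; apply: contraTT => neq_xy.
apply/negP => /comparable_ltgtP[/height_lt|/height_lt|/eqP] //;
  by rewrite ?Exy ?ltnn // (negbTE neq_xy).
Qed.

Lemma chain_height_le A x y : chain A -> x \in A -> y \in A ->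
  (height x < height y)%N -> (x < y)%O.
Proof.
move=> /chainP chA xA yA.
by have [//|/height_lt|->] := comparable_ltgtP (chA _ _ xA yA); lia.
Qed.

Lemma height_bound x : (height x < n.+2)%N.
Proof.
have [A flA xA] := mem_flag x.
rewrite (height_flag flA xA) -(flag_size flA); apply/proper_card/properP.
split; first by apply/subsetP=> y; rewrite inE => /andP[].
by exists x; rewrite ?inE ?ltxx ?andbF.
Qed.

Definition face_at A (h : nat) : T :=
  odflt \bot%O [pick x | (x \in A) && (height x == h)].

(** Heights are injective on a flag of [n.+2] faces and stay below [n.+2], so each value occurs and
    the default of [face_at] is not reached. *)
Lemma face_atP A h : flag A -> (h < n.+2)%N ->
  face_at A h \in A /\ height (face_at A h) = h.
Proof.
move=> flA lt_h; rewrite /face_at; case: pickP => [x /andP[xA /eqP] //|noface].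
pose f x : 'I_n.+2 := inord (height x).
have fK x : f x = height x :> nat by rewrite inordK ?height_bound.
have cardfA : #|f @: A| = n.+2.
  rewrite card_in_imset ?flag_size // => x y xA yA /(congr1 val) /=.
  by rewrite !fK; apply: height_inj (flag_chain flA) _ _ xA yA.
have /eqP fA : f @: A == setT by rewrite eqEcard subsetT cardfA cardsT card_ord /=.
have : Ordinal lt_h \in f @: A by rewrite fA inE.
case/imsetP => x xA /(congr1 val); rewrite /= fK => hE.
by have := noface x; rewrite xA -hE eqxx.
Qed.

Lemma mem_face_at A h : flag A -> (h < n.+2)%N -> face_at A h \in A.
Proof. by move=> flA /(face_atP flA)[]. Qed.

Lemma height_face_at A h : flag A -> (h < n.+2)%N -> height (face_at A h) = h.
Proof. by move=> flA /(face_atP flA)[]. Qed.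

Lemma face_at_height A x : flag A -> x \in A -> face_at A (height x) = x.
Proof.
move=> flA xA; have [fA hf] := face_atP flA (height_bound x).
exact: height_inj (flag_chain flA) _ _ fA xA hf.
Qed.

Lemma face_at_shared A B h : flag A -> flag B -> (h < n.+2)%N ->
  (face_at A h == face_at B h) = (face_at A h \in B).
Proof.
move=> flA flB lt_h; have [fA hA] := face_atP flA lt_h.
apply/eqP/idP => [->|fB]; first exact: mem_face_at.
by have := face_at_height flB fB; rewrite hA.
Qed.

Lemma face_at_lt A h k : flag A -> (h < k < n.+2)%N ->
  (face_at A h < face_at A k)%O.
Proof.
move=> flA /andP[hk kn]; have hn := ltn_trans hk kn.
by apply: chain_height_le (flag_chain flA) _ _ _;
  rewrite ?mem_face_at ?height_face_at.
Qed.

Lemma eq_flags A B : flag A -> flag B ->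
  (forall h, (h < n.+2)%N -> face_at A h = face_at B h) -> A = B.
Proof.
move=> flA flB eqAB; apply/eqP.
rewrite eqEcard !flag_size // leqnn andbT; apply/subsetP=> x xA.
rewrite -(face_at_height flA xA) eqAB ?height_bound //.
by rewrite mem_face_at ?height_bound.
Qed.

Lemma i_adjacentP i A B : (i < n)%N ->
  reflect [/\ flag A, flag B & forall h, (h < n.+2)%N ->
              (face_at A h == face_at B h) = (h != i.+1)]
          (i_adjacent i A B).
Proof.
move=> ltin; apply: (iffP and4P) => [[flA flB neqAB /eqP eqAB] | [flA flB eqAB]].
  have eq_off h : (h < n.+2)%N -> h != i.+1 -> face_at A h = face_at B h.
    move=> lt_h neq_h; apply/eqP; rewrite face_at_shared //.
    have [fA hA] := face_atP flA lt_h.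
    have : face_at A h \in [set x in A | height x != i.+1] by rewrite inE fA hA.
    by rewrite eqAB inE => /andP[].
  split=> // h lt_h; have [Eh|/eq_off->//] := eqVneq h i.+1; last by rewrite eqxx.
  apply: contraNF neqAB => /eqP eqh; apply/eqP/eq_flags => // k lt_k.
  by have [-> | /eq_off->] := eqVneq k i.+1; rewrite -?Eh.
have sub A' B' : flag A' -> flag B' ->
    (forall h, (h < n.+2)%N -> (face_at A' h == face_at B' h) = (h != i.+1)) ->
    [set x in A' | height x != i.+1] \subset [set x in B' | height x != i.+1].
  move=> flA' flB' eqAB'; apply/subsetP => x; rewrite !inE => /andP[xA neq_x].
  rewrite neq_x andbT -(face_at_height flA' xA) -face_at_shared ?height_bound //.
  by rewrite eqAB' ?height_bound.
split=> //.
  have lt_i : (i.+1 < n.+2)%N by lia.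
  by apply/eqP => EAB; have := eqAB _ lt_i; rewrite EAB !eqxx.
rewrite eqEsubset !sub // => h lt_h; by rewrite eq_sym eqAB.
Qed.

Lemma i_adjacent_sym i A B : i_adjacent i A B = i_adjacent i B A.
Proof.
rewrite /i_adjacent [A == B]eq_sym.
by rewrite [[set _ in A | _] == _]eq_sym andbCA.
Qed.

Section Automorphisms.
Variable g : {perm T}.
Hypothesis autg : g \in autgrp T.

Lemma aut_le x y : (g x <= g y)%O = (x <= y)%O.
Proof. by move: autg; rewrite inE => /forallP/(_ x)/forallP/(_ y)/eqP. Qed.

Lemma aut_lt x y : (g x < g y)%O = (x < y)%O.
Proof. by rewrite !lt_neqAle aut_le (inj_eq perm_inj). Qed.

Lemma aut_flag A : flag A -> flag (g @: A).
Proof.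
move=> flA; rewrite flag_card card_imset ?flag_size //; last exact: perm_inj.
rewrite eqxx andbT; apply/chainP => _ _ /imsetP[x xA ->] /imsetP[y yA ->].
rewrite /Order.comparable !aut_le; exact: (chainP _ (flag_chain flA)).
Qed.

Lemma aut_height x : height (g x) = height x.
Proof.
have [A flA xA] := mem_flag x; rewrite (height_flag flA xA).
rewrite (height_flag (aut_flag flA)) ?imset_f //.
rewrite -(card_imset [set y in A | (y < x)%O] (@perm_inj _ g)).
suff -> : [set y in g @: A | (y < g x)%O] = g @: [set y in A | (y < x)%O] by [].
apply/setP => y; rewrite inE; apply/andP/imsetP => [[/imsetP[z zA ->]]|[z]].
  by rewrite aut_lt; exists z; rewrite // inE zA.
by rewrite inE => /andP[zA zx] ->; rewrite aut_lt imset_f.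
Qed.

Lemma aut_face_at A h : flag A -> (h < n.+2)%N ->
  face_at (g @: A) h = g (face_at A h).
Proof.
move=> flA lt_h; have [fA hA] := face_atP flA lt_h.
have := face_at_height (aut_flag flA) (imset_f g fA).
by rewrite aut_height hA.
Qed.

Lemma aut_adjacent i A B : (i < n)%N ->
  i_adjacent i A B -> i_adjacent i (g @: A) (g @: B).
Proof.
move=> ltin /(i_adjacentP _ _ ltin)[flA flB eqAB]; apply/i_adjacentP => //.
split; rewrite ?aut_flag // => h lt_h.
by rewrite !aut_face_at // (inj_eq perm_inj) eqAB.
Qed.

End Automorphisms.
End RankedPoset.

(** * The flag graph of a polytope *)

Definition flag_of d (T : finTBPOrderType d) := {A : {set T} | flag A}.
Arguments flag_of {d} T.

Section FlagGraph.
Variables (n : nat) (d : Order.disp_t) (T : finTBPOrderType d).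
Hypothesis polyT : is_polytope n T.
Implicit Types (A B : {set T}) (x y : flag_of T) (g : {perm T}).

Let flag_size : forall A, flag A -> #|A| = n.+2.
Proof. by case: polyT. Qed.

Lemma diamond_uniq (a b u v w : T) : height b = (height a).+2 ->
  (a < u < b)%O -> (a < v < b)%O -> (a < w < b)%O -> v != u -> w != u -> v = w.
Proof.
move=> hab au av aw; have [_ _ /(_ a b)] := polyT.
have ab : (a < b)%O by case/andP: au; apply: lt_trans.
move=> /(_ ab hab)/eqP/cards2P[y [z [_ Eyz]]].
have mid t : (a < t < b)%O -> (t == y) || (t == z).
  by move=> at_; rewrite -in_set2 -Eyz inE.
by case/orP: (mid _ au) => /eqP->; case/orP: (mid _ av) => /eqP->;
  case/orP: (mid _ aw) => /eqP->; rewrite ?eqxx.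
Qed.

(** The new face lies in the diamond between the faces at heights [i] and [i.+2] and differs from
    the old one, so three faces determine it. Uniqueness of adjacent flags and commutation of
    distant letters both rest on this. *)
Lemma adjacent_local i A A' B B' : (i < n)%N ->
    i_adjacent i A B -> i_adjacent i A' B' ->
    (forall h, (i <= h <= i.+2)%N -> face_at A h = face_at A' h) ->
  face_at B i.+1 = face_at B' i.+1.
Proof.
move=> ltin /(i_adjacentP flag_size _ _ ltin)[flA flB adjAB].
move=> /(i_adjacentP flag_size _ _ ltin)[flA' flB' adjAB'] eqAA'.
have eq_face (C D : {set T}) h : (forall h, (h < n.+2)%N ->
      (face_at C h == face_at D h) = (h != i.+1)) ->
    (h < n.+2)%N -> h != i.+1 -> face_at D h = face_at C h.
  by move=> eqCD lt_h neq_h; apply/esym/eqP; rewrite eqCD.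
have EBi := eq_face _ _ i adjAB; have EBi2 := eq_face _ _ i.+2 adjAB.
have EB'i := eq_face _ _ i adjAB'; have EB'i2 := eq_face _ _ i.+2 adjAB'.
apply: (@diamond_uniq (face_at A i) (face_at A i.+2) (face_at A i.+1)).
- by rewrite !(height_face_at flag_size) //; lia.
- by rewrite !(face_at_lt flag_size) //; lia.
- rewrite -EBi -?EBi2; try lia.
  by rewrite !(face_at_lt flag_size) //; lia.
- rewrite !eqAA'; try lia.
  rewrite -EB'i -?EB'i2; try lia.
  by rewrite !(face_at_lt flag_size) //; lia.
- by rewrite eq_sym adjAB ?eqxx //; lia.
- rewrite eqAA'; last lia.
  by rewrite eq_sym adjAB' ?eqxx //; lia.
Qed.

Lemma adjacent_uniq i A B C : (i < n)%N ->
  i_adjacent i A B -> i_adjacent i A C -> B = C.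
Proof.
move=> ltin adjAB adjAC.
have Ei := adjacent_local ltin adjAB adjAC (fun _ _ => erefl).
move/(i_adjacentP flag_size _ _ ltin): adjAB => [_ flB EB].
move/(i_adjacentP flag_size _ _ ltin): adjAC => [_ flC EC].
apply: (eq_flags flag_size) => // h lt_h.
have [-> //|neq_h] := eqVneq h i.+1.
have := EB h lt_h; have := EC h lt_h; rewrite neq_h.
by move=> /eqP <- /eqP <-.
Qed.

(** The diamond around the face [u] of [A] contains one further face [v]; exchanging [u] for [v]
    gives a chain of full size. *)
Lemma adjacent_ex i A : (i < n)%N -> flag A -> exists B, i_adjacent i A B.
Proof.
move=> ltin flA; have lt_i : (i.+1 < n.+2)%N by lia.
set a := face_at A i; set b := face_at A i.+2; set u := face_at A i.+1.
have [au ub] : (a < u)%O /\ (u < b)%O.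
  by split; apply: (face_at_lt flag_size) => //; lia.
have [ha hb hu] : [/\ height a = i, height b = i.+2 & height u = i.+1].
  by split; apply: (height_face_at flag_size) => //; lia.
have uA : u \in A by apply: (mem_face_at flag_size).
have [_ _ /(_ a b (lt_trans au ub))] := polyT.
rewrite ha hb => /(_ erefl) card2.
have : (0 < #|[set z | (a < z < b)%O] :\ u|)%N.
  by have := cardsD1 u [set z | (a < z < b)%O]; rewrite card2 inE au ub /=; lia.
case/card_gt0P => v /setD1P[neq_vu]; rewrite inE => /andP[av vb].
have hv : height v = i.+1.
  have := height_lt flag_size av; have := height_lt flag_size vb.
  by rewrite ha hb; lia.
have vA : v \notin A.
  apply: contra neq_vu => vA; apply/eqP.
  by apply: (height_inj flag_size) (flag_chain flA) _ _ vA uA _; rewrite hv hu.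
have off_v z : z \in A -> z != u -> (z >=< v)%O.
  move=> zA neq_zu; have hzu : height z != i.+1.
    apply: contraNneq neq_zu => hz; apply/eqP.
    by apply: (height_inj flag_size) (flag_chain flA) _ _ zA uA _; rewrite hz hu.
  have [le_zi|lt_iz] := leqP (height z) i.
    apply: le_comparable; apply: le_trans (ltW av).
    move: le_zi; rewrite leq_eqVlt -ha => /predU1P[/esym Eaz|lt_za].
      rewrite (height_inj flag_size (flag_chain flA) _ _ Eaz) ?lexx //.
      by apply: (mem_face_at flag_size) => //; lia.
    apply/ltW/(chain_height_le flag_size (flag_chain flA)) => //.
    by apply: (mem_face_at flag_size) => //; lia.
  apply: ge_comparable; apply: le_trans (ltW vb) _.
  have : (i.+2 <= height z)%N by lia.
  rewrite leq_eqVlt -hb => /predU1P[Eaz|lt_za].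
    rewrite (height_inj flag_size (flag_chain flA) _ _ Eaz) ?lexx //.
    by apply: (mem_face_at flag_size) => //; lia.
  apply/ltW/(chain_height_le flag_size (flag_chain flA)) => //.
  by apply: (mem_face_at flag_size) => //; lia.
exists (v |: A :\ u); have flB : flag (v |: A :\ u).
  rewrite (flag_card flag_size); apply/andP; split.
    apply/chainP => y z /setU1P[->|/setD1P[yu yA]] /setU1P[->|/setD1P[zu zA]].
    - exact: comparablexx.
    - by rewrite comparable_sym off_v.
    - exact: off_v.
    - exact: (chainP _ (flag_chain flA)).
  rewrite cardsU1 !inE (negbTE vA) andbF /=.
  by have := cardsD1 u A; rewrite uA flag_size // => ->.
apply/and4P; split=> //.
  by apply: contraNneq vA => ->; rewrite setU11.
apply/eqP/setP => z; rewrite !inE.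
have [-> |neq_zv] /= := eqVneq z v; first by rewrite hv eqxx !andbF.
by have [-> |//] := eqVneq z u; rewrite hu eqxx !andbF.
Qed.

Definition adj (i : 'I_n) x : flag_of T :=
  odflt x [pick y | i_adjacent i (val x) (val y)].

Lemma adjP (i : 'I_n) x : i_adjacent i (val x) (val (adj i x)).
Proof.
rewrite /adj; case: pickP => //= no_adj.
have [B adjB] := adjacent_ex (ltn_ord i) (valP x).
have flB : flag B by case/and4P: adjB.
by have := no_adj (exist _ B flB); rewrite /= adjB.
Qed.

Lemma adj_uniq (i : 'I_n) x y : i_adjacent i (val x) (val y) -> adj i x = y.
Proof.
by move=> adj_xy; apply/val_inj/(adjacent_uniq (ltn_ord i) (adjP i x)).
Qed.

Lemma adjK i : involutive (adj i).
Proof. by move=> x; apply: adj_uniq; rewrite i_adjacent_sym adjP. Qed.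

Lemma face_adj (i : 'I_n) x h : (h < n.+2)%N ->
  (face_at (val x) h == face_at (val (adj i x)) h) = (h != i.+1).
Proof. by have /(i_adjacentP flag_size _ _ (ltn_ord i))[_ _] := adjP i x; apply. Qed.

Lemma face_adj_off (i : 'I_n) x h : (h < n.+2)%N -> h != i.+1 ->
  face_at (val (adj i x)) h = face_at (val x) h.
Proof. by move=> lt_h neq_h; apply/esym/eqP; rewrite face_adj. Qed.

Lemma adjC_far (i j : 'I_n) x : (i.+1 < j)%N || (j.+1 < i)%N ->
  adj i (adj j x) = adj j (adj i x).
Proof.
move=> far_ij; apply/esym/adj_uniq; apply/(i_adjacentP flag_size) => //.
split; try exact: valP.
move=> h lt_h; have [->|neq_hj] := eqVneq h j.+1.
  have lt_h' : (j.+1 < n.+2)%N by have := ltn_ord j; lia.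
  have neq_ji : j.+1 != i.+1 by lia.
  rewrite (face_adj_off x lt_h' neq_ji) (face_adj_off (adj j x) lt_h' neq_ji).
  by rewrite face_adj // eqxx.
apply/eqP; have [->|neq_hi] := eqVneq h i.+1; last by rewrite !face_adj_off.
apply: (adjacent_local (ltn_ord i) (adjP i x) (adjP i (adj j x))) => k le_k.
by rewrite face_adj_off //; have := ltn_ord i; lia.
Qed.

Lemma adjC (i j : 'I_n) x : (i.+1 < j)%N -> adj i (adj j x) = adj j (adj i x).
Proof. by move=> ij; rewrite adjC_far // ij. Qed.

Lemma walk_face (I : pred 'I_n) w x h : (h < n.+2)%N -> all I w ->
  (forall i : 'I_n, I i -> i.+1 != h) ->
  face_at (val (walk adj w x)) h = face_at (val x) h.
Proof.
move=> lt_h; elim: w => //= i w IHw /andP[Ii Iw] I_h.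
by rewrite face_adj_off ?IHw // eq_sym I_h.
Qed.

(** From right to left this is strong flag-connectivity: along a path of flags that all contain the
    common faces [D], only letters of [I] can occur. *)
Lemma linkedE (I : pred 'I_n) x y :
  reflect (forall i, ~~ I i -> face_at (val x) i.+1 = face_at (val y) i.+1)
          (linked adj I x y).
Proof.
apply: (iffP idP) => [/linkedP[w Iw <-] i Ii | eq_xy].
  rewrite (walk_face (I := I)) // => [|j Ij]; first by have := ltn_ord i; lia.
  by apply: contraNneq Ii => -[/val_inj <-].
have [_ conn _] := polyT.
have /connectP[p] := conn _ _ (valP x) (valP y).
set D := _ :&: _ => p_path Ey.
have [Dx Dy] : D \subset val x /\ D \subset val y.
  by split; [exact: subsetIl | exact: subsetIr].
have D_face i : ~~ I i -> face_at (val x) i.+1 \in D.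
  move=> Ii; have lt_i : (i.+1 < n.+2)%N by have := ltn_ord i; lia.
  rewrite inE (mem_face_at flag_size) ?(valP x) //= eq_xy //.
  by rewrite (mem_face_at flag_size) ?(valP y).
have {eq_xy}: forall z : flag_of T, D \subset val z -> forall q, path
   [rel A B : {set T} | [&& D \subset A, D \subset B & [exists i : 'I_n, i_adjacent i A B]]]
   (val z) q -> val y = last (val z) q -> linked adj I z y; last first.
  by move/(_ x Dx p); apply.
move=> {p p_path Ey} z Dz q; elim: q z Dz => [|B q IHq] z Dz /=.
  by move=> _ /val_inj->; apply: linked_refl.
move=> /andP[/and3P[_ DB /existsP[i adj_zB]] Bq] Ey.
have flB : flag B by case/and4P: adj_zB.
pose u : flag_of T := exist _ B flB.
have Eu : adj i z = u by apply: adj_uniq.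
(* A letter outside [I] would change a face of [D], yet both flags of this edge contain [D]. *)
have Ii : I i.
  apply: contraT => /D_face fD; set f := face_at _ _ in fD.
  have lt_i : (i.+1 < n.+2)%N by have := ltn_ord i; lia.
  have hf : height f = i.+1 by rewrite (height_face_at flag_size) ?(valP x).
  have := face_adj i z lt_i; rewrite eqxx Eu /= -hf.
  by rewrite !(face_at_height flag_size) ?eqxx ?(valP z) ?(subsetP Dz) ?(subsetP DB).
apply: linked_trans (IHq u _ _ _) => //.
by rewrite -Eu; apply: (@linked_walk _ _ _ _ [:: i]); rewrite /= Ii.
Qed.

Lemma adj_connected x y : linked adj predT x y.
Proof. exact/linkedE. Qed.

Lemma adj_path_intersection : path_intersection adj.
Proof.
move=> I J x y /linkedE Ixy /linkedE Jxy; apply/linkedE => i /=.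
by rewrite negb_and => /orP[/Ixy|/Jxy].
Qed.

Definition flag_act g x : flag_of T := insubd x (g @: val x).

Lemma val_flag_act g x : g \in autgrp T -> val (flag_act g x) = g @: val x.
Proof.
by move=> autg; rewrite insubdK //; apply: (aut_flag flag_size autg) (valP x).
Qed.

Lemma flag_act1 x : flag_act 1 x = x.
Proof.
apply: val_inj; rewrite val_flag_act ?group1 //.
by rewrite (eq_imset _ (@perm1 _)) imset_id.
Qed.

Lemma flag_actM g h x : g \in autgrp T -> h \in autgrp T ->
  flag_act (g * h) x = flag_act h (flag_act g x).
Proof.
move=> autg auth; apply: val_inj; rewrite !val_flag_act ?groupM //.
by rewrite -imset_comp; apply: eq_imset => z; rewrite /= permM.
Qed.

Lemma flag_actK g x : g \in autgrp T -> flag_act g^-1 (flag_act g x) = x.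
Proof. by move=> autg; rewrite -flag_actM ?groupV // mulgV flag_act1. Qed.

Lemma flag_act_adj g i x : g \in autgrp T ->
  flag_act g (adj i x) = adj i (flag_act g x).
Proof.
move=> autg; apply/esym/adj_uniq; rewrite !val_flag_act //.
exact: (aut_adjacent flag_size autg (ltn_ord i) (adjP i x)).
Qed.

Lemma flag_act_walk g w x : g \in autgrp T ->
  flag_act g (walk adj w x) = walk adj w (flag_act g x).
Proof. by move=> autg; elim: w => //= i w IHw; rewrite flag_act_adj ?IHw. Qed.

(** Automorphisms commute with adjacency, so fixing one flag means fixing all of them by
    connectedness, and then each face, as the face of its height in some flag. *)
Lemma flag_act_free g x : g \in autgrp T -> flag_act g x = x -> g = 1.
Proof.
move=> autg gx; apply/permP => z; rewrite perm1.
have [A flA zA] := mem_flag z; pose y : flag_of T := exist _ A flA.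
have gy : flag_act g y = y.
  have /linkedP[w _ <-] := adj_connected x y.
  by rewrite flag_act_walk // gx.
rewrite -(face_at_height flag_size flA zA).
rewrite -(aut_face_at flag_size autg) ?(height_bound flag_size) //.
by rewrite -[A]/(val y) -val_flag_act // gy.
Qed.

Lemma flag_act_inj g h x : g \in autgrp T -> h \in autgrp T ->
  flag_act g x = flag_act h x -> g = h.
Proof.
move=> autg auth eq_gh; apply/eqP; rewrite eq_mulgV1; apply/eqP.
apply: (@flag_act_free _ x); first by rewrite groupM ?groupV.
by rewrite flag_actM ?groupV // eq_gh flag_actK.
Qed.

End FlagGraph.

(** * Orbit maps and the groups generated by the kappa_{i,j} *)

Section OrbitMap.
Variables (n : nat) (gT : finGroupType) (G : {group gT}) (s : nat -> gT).
Variables (X : finType) (r : 'I_n -> X -> X) (F : gT -> X).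
Hypothesis rK : forall i, involutive (r i).
Hypothesis sG : forall j, (0 < j < n)%N -> s j \in G.
Hypothesis Fs : forall (i j : 'I_n) g, i.+1 = j -> g \in G ->
  F (s j * g) = r i (r j (F g)).

(** Letter [i] has rank [i], which the shifted encoding of rank sets places at [i.+1]. *)
Definition ranks (I : {set 'I_n.+2}) : pred 'I_n := fun i => inord i.+1 \in I.

Lemma kappa_in i j : kappa n s i j \in G.
Proof.
rewrite /kappa; case: ifP => // /andP[i0 jn].
rewrite big_seq; apply: group_prod => k; rewrite mem_index_iota => k_ij.
by apply: sG; lia.
Qed.

(** The product telescopes: every letter strictly between [i] and [j] occurs twice in succession and
    cancels. *)
Lemma orbit_kappa (i j : 'I_n) g : (i < j)%N -> g \in G ->
  F (kappa n s i.+1 j * g) = r i (r j (F g)).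
Proof.
move=> ij Gg; rewrite /kappa ltn_ord /=.
have [e Ej] : exists e, (i + e.+1)%N = j by exists (j - i).-1; lia.
elim: e i ij Ej => [|e IHe] i ij Ej.
  have Eij : i.+1 = j by lia.
  by rewrite Eij big_nat1; apply: Fs.
have lt_i : (i.+1 < n)%N by have := ltn_ord j; lia.
rewrite big_ltn; last by lia.
have GP : \prod_((Ordinal lt_i).+1 <= k < j.+1) s k * g \in G.
  rewrite groupM // big_seq; apply: group_prod => k.
  by rewrite mem_index_iota /= => k_ij; apply: sG; have := ltn_ord j; lia.
have := Fs (i := i) (j := Ordinal lt_i) erefl GP.
by rewrite IHe ?rK -?mulgA //=; lia.
Qed.

Lemma kappa_group_sub (I : {set 'I_n.+2}) : kappa_group s I \subset G.
Proof. by rewrite gen_subG; apply/subsetP => _ /imset2P[a b _ _ ->]; apply: kappa_in. Qed.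

Lemma kappa_group_step (I : {set 'I_n.+2}) (i j : 'I_n) : ranks I i -> ranks I j ->
  exists2 k, k \in kappa_group s I &
    forall g, g \in G -> F (k * g) = r i (r j (F g)).
Proof.
have step (k l : 'I_n) : ranks I k -> ranks I l -> (k < l)%N ->
    kappa n s k.+1 l \in kappa_group s I.
  rewrite /ranks => Ik Il kl; apply/mem_gen/imset2P.
  have hk : (inord k.+1 : 'I_n.+2) = k.+1 :> nat.
    by apply: inordK; have := ltn_ord k; lia.
  have hl : (inord l.+1 : 'I_n.+2) = l.+1 :> nat.
    by apply: inordK; have := ltn_ord l; lia.
  exists (inord k.+1 : 'I_n.+2) (inord l.+1 : 'I_n.+2) => //.
    by rewrite inE Il hk hl.
  by rewrite /= hk hl.
move=> Ii Ij; have [ij|ji|/val_inj<-] := ltngtP i j.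
- by exists (kappa n s i.+1 j) => [|g]; [apply: step | apply: orbit_kappa].
- exists (kappa n s j.+1 i)^-1 => [|g Gg]; first by rewrite groupV step.
  have Gkg : (kappa n s j.+1 i)^-1 * g \in G by rewrite groupM // groupV kappa_in.
  have := orbit_kappa ji Gkg; rewrite mulKVg => ->.
  by rewrite !rK.
- by exists 1 => [|g _]; rewrite ?group1 // mul1g rK.
Qed.

(** Letters are taken in pairs. Together with [kappa_group_walk] this matches the elements of
    [kappa_group s I] with the even walks in the letters of [I]. *)
Lemma walk_kappa_group (I : {set 'I_n.+2}) w : all (ranks I) w -> ~~ odd (size w) ->
  exists2 k, k \in kappa_group s I &
    forall g, g \in G -> F (k * g) = walk r w (F g).
Proof.
have [N] := ubnP (size w); elim: N w => // N IHN [|i [|j w]] //= leN.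
  by exists 1 => [|g _]; rewrite ?group1 // mul1g.
case/and3P => Ii Ij Iw; rewrite negbK => even_w.
have [k Ik kE] := kappa_group_step Ii Ij.
have [l Il lE] := IHN w (ltnW leN) Iw even_w.
exists (k * l); rewrite ?groupM // => g Gg.
by rewrite -mulgA kE ?lE // groupM // (subsetP (kappa_group_sub I)).
Qed.

Lemma kappa_group_walk (I : {set 'I_n.+2}) k : k \in kappa_group s I ->
  exists w, [/\ all (ranks I) w, ~~ odd (size w) &
    forall g, g \in G -> F (k * g) = walk r w (F g)].
Proof.
case/gen_prodgP => m [c cI ->]; elim: m c cI => [|m IHm] c cI.
  by exists [::]; split=> // g _; rewrite big_ord0 mul1g.
have [w [Iw even_w wE]] := IHm (fun i => c (lift ord0 i)) (fun i => cI _).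
have: exists v, [/\ all (ranks I) v, ~~ odd (size v) &
    forall g, g \in G -> F (c ord0 * g) = walk r v (F g)].
  have /imset2P[a b Ia] := cI ord0; rewrite inE => /andP[Ib ab] ->.
  (* The encodings [0] and [n.+1] of the ranks -1 and [n] correspond to no letter; there [kappa] is
     1 and the empty walk serves. *)
  case: (posnP a) => [a0|a_gt0].
    by exists [::]; split=> // g _; rewrite /kappa /= a0 mul1g.
  case: (ltnP b.-1 n) => [ltbn|lenb]; last first.
    by exists [::]; split=> // g _; rewrite /kappa /= (ltnNge b.-1) lenb andbF mul1g.
  have ltan : (a.-1 < n)%N by lia.
  exists [:: Ordinal ltan; Ordinal ltbn]; split=> //=; rewrite /ranks /=.
    rewrite !prednK ?(leq_trans _ ab) // ?inord_val ?Ia ?Ib //; lia.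
  move=> g Gg; rewrite -(orbit_kappa (i := Ordinal ltan) (j := Ordinal ltbn)) //=.
    by rewrite prednK.
  by lia.
case=> v [Iv even_v vE]; exists (v ++ w); split.
- by rewrite all_cat Iv.
- by rewrite size_cat oddD (negbTE even_v).
move=> g Gg; rewrite big_ord_recl -mulgA vE ?wE ?walk_cat //.
rewrite groupM // group_prod // => i _.
by apply: (subsetP (kappa_group_sub I)); apply: mem_gen.
Qed.

Lemma kappa_group_rot : kappa_group s [set: 'I_n.+2] \subset rot_group n s.
Proof.
rewrite gen_subG; apply/subsetP => _ /imset2P[a b _ _ ->].
rewrite /kappa; case: ifP => // /andP[a0 bn].
rewrite big_seq; apply: group_prod => k; rewrite mem_index_iota => k_ab.
have kn : (k < n)%N by lia.
by apply: mem_gen; apply/imsetP; exists (Ordinal kn); rewrite // inE /=; lia.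
Qed.

Variable c : X -> bool.
Hypothesis cr : forall i x, c (r i x) = ~~ c x.
Hypothesis r_int : path_intersection r.
Hypothesis Finj : {in G &, injective F}.

(** An element of both groups is reached from [F 1] by walks in either set of letters, hence by one
    in the common letters. Colours make that walk even, so it comes from an element of
    [kappa_group s (I :&: J)], which is the given one as [F] is injective. *)
Lemma orbit_intersection_property : intersection_property n s.
Proof.
move=> I J; apply/eqP; rewrite eqEsubset; apply/andP; split; last first.
  rewrite subsetI !genS //; apply/subsetP => k /imset2P[a b];
    rewrite !inE => /andP[Ia Ja] /andP[/andP[Ib Jb] ab] ->;
    by apply/imset2P; exists a b; rewrite // inE ?Ib ?Jb.
apply/subsetP => k /setIP[Ik Jk].
have Gk : k \in G := subsetP (kappa_group_sub I) k Ik.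
have [w [Iw even_w /(_ 1 (group1 G))]] := kappa_group_walk Ik.
have [v [Jv _ /(_ 1 (group1 G))]] := kappa_group_walk Jk.
rewrite mulg1 => vE wE.
have /linkedP[z IJz zE] : linked r (predI (ranks I) (ranks J)) (F 1) (F k).
  by apply: r_int; apply/linkedP; [exists w | exists v].
have even_z : ~~ odd (size z).
  have := congr1 c (etrans zE wE); rewrite !(colour_walk cr) => /addIb ->.
  exact: even_w.
have IJz' : all (ranks (I :&: J)) z.
  by apply: sub_all IJz => i; rewrite /= /ranks inE.
have [l IJl /(_ 1 (group1 G))] := walk_kappa_group IJz' even_z.
rewrite mulg1 zE => /Finj <- //.
exact: (subsetP (kappa_group_sub (I :&: J))).
Qed.

End OrbitMap.

(** * Rotation groups of two-coloured flag graphs *)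

Section ColouredFlags.
Variables (n : nat) (d : Order.disp_t) (T : finTBPOrderType d).
Hypothesis polyT : is_polytope n T.
Variable c : flag_of T -> bool.
Hypothesis cr : forall (i : 'I_n) x, c (adj i x) = ~~ c x.
Implicit Types (x y : flag_of T) (g : {perm T}).
Let adjKT : forall i : 'I_n, involutive (@adj n d T i).
Proof. exact: adjK. Qed.

(** Automorphisms commute with walks, so each preserves the colour of all flags or of none. *)
Lemma colour_act g x y : g \in autgrp T ->
  (c (flag_act g x) == c x) = (c (flag_act g y) == c y).
Proof.
move=> autg; have /linkedP[w _ <-] := adj_connected polyT x y.
rewrite (flag_act_walk polyT) // !(colour_walk cr).
by case: (c x) (c _) (odd _) => [] [] [].
Qed.

Section Rotations.
Variables (s : nat -> {perm T}) (x0 : flag_of T).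
Hypothesis s_aut : forall j, (0 < j < n)%N -> s j \in autgrp T.
Hypothesis s_rot : forall i j : 'I_n, i.+1 = j ->
  flag_act (s j) x0 = adj i (adj j x0).

Lemma rot_orbit_map (i j : 'I_n) g : i.+1 = j -> g \in autgrp T ->
  flag_act (s j * g) x0 = adj i (adj j (flag_act g x0)).
Proof.
move=> ij autg; have sj : s j \in autgrp T by apply: s_aut; have := ltn_ord j; lia.
by rewrite (flag_actM polyT) // (s_rot ij) !(flag_act_adj polyT).
Qed.

Lemma rot_group_aut : rot_group n s \subset autgrp T.
Proof.
rewrite gen_subG; apply/subsetP => k /imsetP[j]; rewrite inE => j0 ->.
by rewrite s_aut // j0 ltn_ord.
Qed.

Lemma rot_group_trans x : c x = c x0 ->
  exists2 g, g \in rot_group n s & flag_act g x0 = x.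
Proof.
move=> cx; have /linkedP[w _ wE] := adj_connected polyT x0 x.
have even_w : ~~ odd (size w).
  by move: cx; rewrite -wE (colour_walk cr); case: (odd _) (c x0) => [] [].
have allw : all (ranks [set: 'I_n.+2]) w by apply/allP => i _; rewrite /ranks inE.
have [k kK kE] :=
  walk_kappa_group adjKT s_aut rot_orbit_map allw even_w.
exists k; first exact: (subsetP (kappa_group_rot _ _)).
by have := kE 1 (group1 _); rewrite mulg1 (flag_act1 polyT) wE.
Qed.

(** An automorphism that keeps the colour of [x0] agrees at [x0] with some rotation, by transitivity
    on that colour class, and equals it by freeness. *)
Lemma mem_rot_group g :
  (g \in rot_group n s) = (g \in autgrp T) && (c (flag_act g x0) == c x0).
Proof.
apply/idP/andP => [|[autg /eqP /rot_group_trans[h hK hE]]].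
  have grpH : group_set [set g in autgrp T | c (flag_act g x0) == c x0].
    apply/group_setP; split.
      by apply/setIdP; rewrite group1 (flag_act1 polyT) eqxx.
    move=> g1 g2 /setIdP[a1 /eqP c1] /setIdP[a2 c2]; apply/setIdP.
    rewrite groupM //= (flag_actM polyT) // -[X in _ == X]c1.
    by rewrite (colour_act _ x0).
  suff /subsetP sub : rot_group n s \subset Group grpH by move=> /sub /setIdP.
  rewrite gen_subG; apply/subsetP => k /imsetP[j]; rewrite inE => j0 ->.
  have i_n : (j.-1 < n)%N by have := ltn_ord j; lia.
  have ij : (Ordinal i_n).+1 = j by rewrite /=; lia.
  by apply/setIdP; rewrite s_aut ?j0 ?ltn_ord //= (s_rot ij) !cr negbK.
by rewrite -(flag_act_inj polyT _ autg hE) // (subsetP rot_group_aut).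
Qed.

(** On flags coloured like [x0] the iterated walk is the action of a power of [s j]; the other
    colour is reached through letter [j]. *)
Lemma rot_order_walk (i j : 'I_n) m x : i.+1 = j -> s j ^+ m = 1 ->
  iter m (fun x => adj i (adj j x)) x = x.
Proof.
move=> ij sm; wlog cx : x / c x = c x0 => [IH|].
  have [/IH//|neq_c] := eqVneq (c x) (c x0).
  have cjx : c (adj j x) = c x0.
    by rewrite cr; move: neq_c; case: (c x) (c x0) => [] [].
  pose f x := adj i (adj j x).
  (* Letter [j] conjugates [f] to its inverse. As [iter m f] fixes [adj j x], its injectivity then
     gives [iter m f x = x]. *)
  have Eiter k y : iter k f (adj j (iter k f y)) = adj j y.
    elim: k y => // k IHk y; rewrite iterSr /= /f adjKT adjKT.
    exact: IHk.
  have := Eiter m x; rewrite -[in RHS](IH _ cjx).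
  have inj k : injective (iter k f).
    elim: k => // k IHk y z /= /(can_inj (adjKT i))/(can_inj (adjKT j)).
    exact: IHk.
  by move/inj/(can_inj (adjKT j)).
have [g /(subsetP rot_group_aut) autg <-] := rot_group_trans cx.
have sj : s j \in autgrp T by apply: s_aut; have := ltn_ord j; lia.
have iterE k : iter k (fun x => adj i (adj j x)) (flag_act g x0) =
    flag_act (s j ^+ k * g) x0.
  elim: k => [|k IHk]; first by rewrite expg0 mul1g.
  by rewrite iterS IHk expgS -mulgA (rot_orbit_map ij) // groupM ?groupX.
by rewrite iterE sm mul1g.
Qed.

End Rotations.
End ColouredFlags.

(** * Reflections, and two-colourings of the flags of directly regular and of chiral polytopes *)

Section RegularPolytopes.
Variables (n : nat) (d : Order.disp_t) (T : finTBPOrderType d).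
Hypothesis polyT : is_polytope n T.

Lemma chiral_rotationsP s (x0 : flag_of T) :
  chiral_rotations n (val x0) s ->
  (forall j, (0 < j < n)%N -> s j \in autgrp T) /\
  (forall i j : 'I_n, i.+1 = j -> flag_act (s j) x0 = adj i (adj j x0)).
Proof.
move=> rot_s; split=> [j /rot_s[] //|i j ij].
have [|autj [Psi adjPsi adjs]] := rot_s j; first by have := ltn_ord j; lia.
have flPsi : flag Psi by case/and4P: adjPsi.
pose y : flag_of T := exist _ Psi flPsi.
have -> : adj j x0 = y by apply: adj_uniq.
have ij1 : j.-1 = i :> nat by rewrite -ij.
by apply/esym/(adj_uniq polyT); rewrite (val_flag_act polyT) // -ij1.
Qed.

Section Reflections.
Variables (rho : nat -> {perm T}) (x0 : flag_of T).
Hypothesis refl_rho : reflections n (val x0) rho.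

Lemma reflection_aut i : (i < n)%N -> rho i \in autgrp T.
Proof. by case/refl_rho. Qed.

Lemma reflection_act (i : 'I_n) : flag_act (rho i) x0 = adj i x0.
Proof.
have [auti adji] := refl_rho (ltn_ord i).
by apply/esym/(adj_uniq polyT); rewrite (val_flag_act polyT).
Qed.

Lemma rot_of_aut j : (0 < j < n)%N -> rot_of rho j \in autgrp T.
Proof. by move=> jn; rewrite groupM // reflection_aut //; lia. Qed.

Lemma rot_of_act (i j : 'I_n) : i.+1 = j ->
  flag_act (rot_of rho j) x0 = adj i (adj j x0).
Proof.
move=> ij; rewrite /rot_of -ij /= ij (flag_actM polyT) ?reflection_aut //.
by rewrite reflection_act (flag_act_adj polyT) ?reflection_act // reflection_aut.
Qed.

Lemma reflectionsM (i j : 'I_n) g : g \in autgrp T ->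
  flag_act (rho i * rho j * g) x0 = adj i (adj j (flag_act g x0)).
Proof.
move=> autg; rewrite !(flag_actM polyT) ?groupM ?reflection_aut //.
by rewrite reflection_act !(flag_act_adj polyT) ?reflection_aut // reflection_act
  (flag_act_adj polyT).
Qed.

Lemma reflection_sq (i : 'I_n) : rho i * rho i = 1.
Proof.
apply: (flag_act_inj polyT (x := x0)); rewrite ?groupM ?reflection_aut ?group1 //.
by rewrite -[_ * _]mulg1 reflectionsM ?group1 // (adjK polyT).
Qed.

Lemma reflection_far (i j : 'I_n) : (i.+1 < j)%N || (j.+1 < i)%N ->
  rho i * rho j * (rho i * rho j) = 1.
Proof.
move=> far_ij; apply: (flag_act_inj polyT (x := x0));
  rewrite ?groupM ?reflection_aut ?group1 //.
rewrite reflectionsM ?groupM ?reflection_aut //.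
rewrite -[rho i * rho j]mulg1 reflectionsM ?group1 //.
by rewrite (adjC_far polyT _ far_ij) !(adjK polyT).
Qed.

Lemma reflections_gen (K : {group {perm T}}) :
  (forall i, (i < n)%N -> rho i \in K) -> autgrp T \subset K.
Proof.
move=> rhoK; apply/subsetP => g autg.
have /linkedP[w _ wE] := adj_connected polyT x0 (flag_act g x0).
have [k kK /andP[autk /eqP kE]] : exists2 k, k \in K &
    (k \in autgrp T) && (flag_act k x0 == walk (@adj n d T) w x0).
  elim: w {wE} => [|i w [k kK /andP[autk /eqP kE]]].
    by exists 1; rewrite ?group1 //= (flag_act1 polyT).
  exists (rho i * k); first by rewrite groupM ?rhoK.
  rewrite groupM ?reflection_aut //= (flag_actM polyT) ?reflection_aut //.
  by rewrite reflection_act (flag_act_adj polyT) // kE.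
by rewrite -(flag_act_inj polyT autk autg (etrans kE wE)).
Qed.

End Reflections.

(** The colour tells whether a flag lies in the orbit of the base flag under the rotation group [H].
    Index two puts every reflection outside [H], so adjacency changes the colour. *)
Lemma directly_regular_colour (y0 : flag_of T) : (0 < n)%N ->
  directly_regular n T -> exists c : flag_of T -> bool,
    (forall (i : 'I_n) x, c (adj i x) = ~~ c x) /\ c y0.
Proof.
move=> n_gt0 [regT [Phi [rho [flPhi refl_rho index2]]]].
pose x0 : flag_of T := exist _ Phi flPhi.
pose H := [group of rot_group n (rot_of rho)].
have autrho i : (i < n)%N -> rho i \in autgrp T := @reflection_aut rho x0 refl_rho i.
have sHaut : H \subset autgrp T.
  rewrite gen_subG; apply/subsetP => k /imsetP[j]; rewrite inE => j0 ->.
  by apply: (@rot_of_aut rho x0 refl_rho); rewrite j0 /=.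
(* Products of consecutive reflections are in [H], so the reflections are all in [H] or all outside
   it. *)
have rho_step k : (k < n)%N -> (rho k \in H) = (rho 0 \in H).
  elim: k => // k IHk kn; rewrite -IHk; last exact: ltnW.
  have rotH : rho k * rho k.+1 \in H.
    by apply: mem_gen; apply/imsetP; exists (Ordinal kn); rewrite ?inE.
  by apply/idP/idP => rhoH; move: rotH; rewrite ?(groupMl _ rhoH) ?(groupMr _ rhoH).
have rhoN i : (i < n)%N -> rho i \notin H.
  move=> lti; rewrite rho_step //; apply/negP => rho0.
  have sub : autgrp T \subset H.
    apply: (@reflections_gen rho x0 refl_rho) => j ltj.
    by rewrite rho_step.
  by move: index2; rewrite -[rot_group n _]/(gval H) (eqP (_ : autgrp T :==: H))
    ?indexgg // eqEsubset sub.
pose c x := [exists g in H, flag_act g x0 == x].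
have cP g : g \in autgrp T -> c (flag_act g x0) = (g \in H).
  move=> autg; apply/exists_inP/idP => [[h hH /eqP hg]|gH]; last by exists g.
  by rewrite -(flag_act_inj polyT _ autg hg) // (subsetP sHaut).
have actT x : exists2 g, g \in autgrp T & flag_act g x0 = x.
  have flx : val x \in flags T by rewrite inE (valP x).
  have fl0 : val x0 \in flags T by rewrite inE (valP x0).
  have := atransP regT _ fl0 => Eorb; move: flx; rewrite -Eorb.
  case/orbitP => g autg gE; exists g => //; apply: val_inj.
  by rewrite (val_flag_act polyT).
have cr (i : 'I_n) x : c (adj i x) = ~~ c x.
  have [g autg <-] := actT x; rewrite -(flag_act_adj polyT) //.
  rewrite -(reflection_act (x0 := x0) refl_rho) -(flag_actM polyT) ?autrho //.
  have autrg : rho i * g \in autgrp T by rewrite groupM ?autrho.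
  rewrite !cP //.
  case: (boolP (g \in H)) => gH; first by rewrite groupMr // (negbTE (rhoN i _)).
  (* By index two, this coset fills the complement of [H]: one inclusion and equal cardinals. *)
  have sub : (rho i)^-1 *: H \subset autgrp T :\: H.
    apply/subsetP => _ /lcosetP[h hH ->]; apply/setDP; split.
      by rewrite groupM ?groupV ?autrho // (subsetP sHaut).
    by rewrite groupMr // groupV rhoN.
  have card_eq : #|(rho i)^-1 *: H| = #|autgrp T :\: H|.
    rewrite card_lcoset cardsD (setIidPr sHaut).
    have := Lagrange sHaut; rewrite -[gval H]/(rot_group n (rot_of rho)) index2.
    by rewrite muln2 -addnn => <-; rewrite addnK.
  have : g \in (rho i)^-1 *: H.
    have /eqP -> : (rho i)^-1 *: H == autgrp T :\: H by rewrite eqEcard sub card_eq leqnn.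
    by apply/setDP.
  by rewrite mem_lcoset invgK.
(* The base flag supplied by direct regularity may differ from [y0], so the colours are renamed to
   give [y0] the value [true]. *)
exists (fun x => c x == c y0); rewrite eqxx; split=> // i x.
by rewrite cr; case: (c x) (c y0) => [] [].
Qed.

(** There are only two flag orbits and adjacent flags lie in different ones, so membership in the
    orbit of [x0] is a proper colouring. *)
Lemma chiral_colour (x0 : flag_of T) : chiral n T ->
  exists c : flag_of T -> bool, [/\ forall (i : 'I_n) x, c (adj i x) = ~~ c x, c x0 &
    forall g, g \in autgrp T -> c (flag_act g x0)].
Proof.
case=> orb2 adj_orb; pose orb A := orbit ('P^*)%act (autgrp T) A.
exists (fun x => val x \in orb (val x0)); split=> [i x||g autg].
- have adjx := adj_orb _ _ _ (adjP polyT i x).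
  have orbF (y : flag_of T) : orb (val y) \in orb @: flags T.
    by apply: imset_f; rewrite inE (valP y).
  have memE (y z : flag_of T) : (val y \in orb (val z)) = (orb (val y) == orb (val z)).
    by rewrite /orb -orbit_eq_mem.
  rewrite !memE; move: adjx; rewrite -/(orb _) memE.
  move: (orbF x) (orbF (adj i x)) (orbF x0).
  have /eqP/cards2P[O1 [O2 [neqO ->]]] := orb2.
  by rewrite !inE => /orP[] /eqP-> /orP[] /eqP-> /orP[] /eqP->;
    rewrite ?eqxx // ?(eq_sym O2) ?(negbTE neqO).
- exact: orbit_refl.
- by rewrite (val_flag_act polyT) //; apply: (mem_orbit ('P^*)%act (val x0) autg).
Qed.

End RegularPolytopes.

(** * The polytope of a two-coloured maniplex *)

(** An abstract two-coloured flag graph; [step_intersection] is the condition that turns its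
    residues into the faces of a polytope. *)
Record maniplex (n : nat) := Maniplex {
  mflag :> finType;
  step : 'I_n -> mflag -> mflag;
  stepK : forall i, involutive (step i);
  stepC : forall (i j : 'I_n) x, (i.+1 < j)%N -> step i (step j x) = step j (step i x);
  colour : mflag -> bool;
  colour_step : forall i x, colour (step i x) = ~~ colour x;
  step_connected : forall x y, linked step predT x y;
  step_intersection : path_intersection step;
  base_flag : mflag }.

Section FacePoset.
Variables (n : nat) (M : maniplex n).
Local Notation st := (@step n M).
Implicit Types (x y : M) (h : 'I_n.+2).

(** Starting from connectedness, path intersection removes the letters outside [I] one at a time. *)
Lemma linked_offs (I : pred 'I_n) x y :
  (forall i, ~~ I i -> linked st (off i.+1) x y) -> linked st I x y.
Proof.
move=> offI.
have: forall e : seq 'I_n, (forall i, i \in e -> linked st (off i.+1) x y) ->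
    linked st (fun i => i \notin e) x y.
  elim=> [|i e IHe] off_e; first exact: step_connected.
  have off_i := off_e i (mem_head i e).
  have /IHe off_e' : forall j, j \in e -> linked st (off j.+1) x y.
    by move=> j je; apply: off_e; rewrite inE je orbT.
  apply: linked_sub (step_intersection off_i off_e') => j /= /andP[ij je].
  rewrite inE negb_or je andbT; move: ij; rewrite /off eqSS.
  by apply: contraNneq => ->.
move=> /(_ [seq i <- enum 'I_n | ~~ I i]) all_off.
apply: linked_sub (all_off _) => [i|i]; rewrite mem_filter mem_enum andbT.
  by rewrite negbK.
exact: offI.
Qed.

Definition residue (h : nat) x : {set M} := [set y | linked st (off h) x y].

Lemma residue_eq h x y : (y \in residue h x) = (residue h x == residue h y).
Proof.
have symM := linked_sym (@stepK n M).
apply/idP/eqP => [|Exy].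
  rewrite inE => xy.
  apply/setP => z; rewrite !inE; apply/idP/idP; apply: linked_trans => //.
  exact: symM.
have : y \in residue h y by rewrite inE linked_refl.
by rewrite -Exy.
Qed.

Lemma residue_walk (h : nat) w x : all (off h) w -> residue h (walk st w x) = residue h x.
Proof.
move=> hw; apply/setP => z; rewrite !inE.
have lw := linked_walk st x hw; apply/idP/idP; apply: linked_trans => //.
exact: linked_sym (@stepK n M) _ _ _ lw.
Qed.

(** The height is stored beside the residue because at heights [0] and [n.+1] the residue is all of
    [M], while the least and greatest faces must differ. *)
Definition face := {z : 'I_n.+2 * {set M} | [exists x, z.2 == residue z.1 x]}.
HB.instance Definition _ := Finite.on face.

Implicit Types (z : face).
Definition fheight z : 'I_n.+2 := (val z).1.
Definition fresidue z : {set M} := (val z).2.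

Fact mk_face_subproof h x : [exists y, (h, residue h x).2 == residue (h, residue h x).1 y].
Proof. by apply/existsP; exists x. Qed.
Definition mk_face h x : face := exist _ (h, residue h x) (mk_face_subproof h x).

Lemma mk_face_eq h x y : (mk_face h x == mk_face h y) = linked st (off h) x y.
Proof.
rewrite -val_eqE /= xpair_eqE eqxx /=.
by rewrite -[linked _ _ _ _](in_set (fun y => linked st (off h) x y)) residue_eq.
Qed.

Lemma mem_mk_face h x : x \in fresidue (mk_face h x).
Proof. by rewrite inE linked_refl. Qed.

Lemma face_in z x : x \in fresidue z -> z = mk_face (fheight z) x.
Proof.
case: z => [[h C] /= hC]; rewrite /fresidue /fheight /= => xC.
apply: val_inj; rewrite /=; have /existsP[y /eqP /= Ey] := hC.
by congr pair; move: xC; rewrite Ey residue_eq => /eqP.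
Qed.

Lemma face_mk z : exists x, x \in fresidue z.
Proof.
have /existsP[x /eqP Ex] := valP z; exists x.
by rewrite /fresidue Ex inE linked_refl.
Qed.

Definition face_le z z' :=
  (fheight z <= fheight z')%N && [exists x, (x \in fresidue z) && (x \in fresidue z')].

Lemma face_le_refl : reflexive face_le.
Proof.
move=> z; have [x xz] := face_mk z; rewrite /face_le leqnn.
by apply/existsP; exists x; rewrite xz.
Qed.

Lemma face_le_anti : antisymmetric face_le.
Proof.
move=> z z' /andP[/andP[le1 /existsP[x /andP[xz xz']]] /andP[le2 _]].
have Eh : fheight z = fheight z' by apply/val_inj/eqP; rewrite eqn_leq le1.
by rewrite (face_in xz) (face_in xz') Eh.
Qed.

Lemma walk_residue (h : nat) w x : all (off h) w ->
  walk st w x \in residue h x.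
Proof. by move=> hw; rewrite inE linked_walk. Qed.

(* A flag of the middle face can be moved below that face without leaving
   the upper faces, until it meets a prescribed lower face. *)
Lemma face_le_below z z' x : face_le z z' -> (fheight z < fheight z')%N ->
  x \in fresidue z' -> exists w, [/\ all (below (fheight z')) w,
     walk st w x \in fresidue z & walk st w x \in fresidue z'].
Proof.
move=> /andP[_ /existsP[y /andP[yz yz']]] lt_zz' xz'.
have /linkedP[w hw wE] : linked st (off (fheight z')) x y.
  by rewrite -mk_face_eq -!face_in.
have below_off : subpred (@below n (fheight z')) (off (fheight z')).
  by move=> i; rewrite /below /off; lia.
exists (filter (below (fheight z')) w); split; first exact: filter_all.
  rewrite (face_in yz) [y in mk_face _ y](_ : y = walk st (filter (above (fheight z')) w)
     (walk st (filter (below (fheight z')) w) x)); last first.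
    by rewrite -walk_split_above //; exact: stepC.
  rewrite /fresidue /= residue_walk; first by rewrite inE linked_refl.
  apply: sub_all (filter_all (above (fheight z')) w) => i.
  by rewrite /above /off; lia.
rewrite (face_in xz') /fresidue /=; apply: walk_residue.
by apply: (sub_all below_off); apply: filter_all.
Qed.

(** A flag shared by [z'] and [z''] is moved into [z] by letters below [z']; these leave the height
    of [z''] alone, so the flag stays in [z'']. *)
Lemma face_le_trans : transitive face_le.
Proof.
move=> z' z z'' le1 le2; have /andP[h1 _] := le1; have /andP[h2 e2] := le2.
rewrite /face_le (leq_trans h1 h2) /=.
have /existsP[y /andP[yz' yz'']] := e2.
have [Eh|lt1] := eqVneq (fheight z) (fheight z').
  suff -> : z = z' by [].
  have /andP[_ /existsP[x /andP[xz xz']]] := le1.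
  by rewrite (face_in xz) (face_in xz') Eh.
have lt1' : (fheight z < fheight z')%N by rewrite ltn_neqAle lt1.
have [w [wb wz wz']] := face_le_below le1 lt1' yz'.
apply/existsP; exists (walk st w y); rewrite wz /=.
rewrite (face_in yz'') /fresidue /=; apply: walk_residue.
by apply: sub_all wb => i; rewrite /below /off; lia.
Qed.

HB.instance Definition _ := Order.Le_isPOrder.Build (Order.Disp tt tt) face
  face_le_refl face_le_anti face_le_trans.

Lemma face_leE z z' : (z <= z')%O = face_le z z'.
Proof. by []. Qed.

Fact face_bot z : (mk_face ord0 (base_flag M) <= z)%O.
Proof.
have [x xz] := face_mk z; rewrite face_leE /face_le leq0n /=.
apply/existsP; exists x; rewrite xz andbT /fresidue /= inE.
by apply: linked_sub (step_connected _ _).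
Qed.

Fact face_top z : (z <= mk_face ord_max (base_flag M))%O.
Proof.
have [x xz] := face_mk z; rewrite face_leE /face_le -ltnS ltn_ord /=.
apply/existsP; exists x; rewrite xz /fresidue /= inE.
by apply: linked_sub (step_connected _ _) => i _; rewrite /off; have := ltn_ord i; lia.
Qed.

HB.instance Definition _ := Order.hasBottom.Build (Order.Disp tt tt) face face_bot.
HB.instance Definition _ := Order.hasTop.Build (Order.Disp tt tt) face face_top.

Lemma mk_face_le h h' x : (mk_face h x <= mk_face h' x)%O = (h <= h')%N.
Proof.
rewrite face_leE /face_le /fheight /=; case: leqP => //= _.
by apply/existsP; exists x; rewrite !mem_mk_face.
Qed.

Definition mchain x : {set face} := [set mk_face h x | h : 'I_n.+2].

Lemma mchainP x z : reflect (x \in fresidue z) (z \in mchain x).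
Proof.
apply: (iffP imsetP) => [[h _ ->]|/face_in Ez]; first exact: mem_mk_face.
by exists (fheight z).
Qed.

Lemma mem_mchain h x : mk_face h x \in mchain x.
Proof. exact/mchainP/mem_mk_face. Qed.

Lemma mk_face_inj x : injective (mk_face^~ x).
Proof. by move=> h h' /(congr1 fheight). Qed.

Lemma mchain_card x : #|mchain x| = n.+2.
Proof. by rewrite card_imset ?card_ord //; apply: mk_face_inj. Qed.

Lemma mchain_chain x : chain (mchain x).
Proof.
apply/chainP => _ _ /imsetP[h _ ->] /imsetP[h' _ ->].
by rewrite /Order.comparable !mk_face_le leq_total.
Qed.

(** Built from the top down: a flag lying in all higher faces of [A] is moved into the next face [z]
    by letters below [w], the face of [A] just above [z], and so stays in the faces already met. *)
Lemma chain_common (A : {set face}) : chain A -> exists x, A \subset mchain x.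
Proof.
move=> /chainP chA.
have eq_height : {in A &, injective fheight}.
  move=> z z' zA zA' Eh; have := chA z z' zA zA'.
  rewrite /Order.comparable !face_leE /face_le Eh leqnn /=.
  suff common x : x \in fresidue z -> x \in fresidue z' -> z = z'.
    by case/orP => /existsP[x /andP[]]; [|move=> /[swap]]; apply: common.
  by move=> /face_in-> /face_in->; rewrite Eh.
(* Stage [k] treats the faces of height at least [n.+2 - k]; stage [n.+2] covers the whole chain. *)
suff: forall k, exists x, forall z, z \in A -> (n.+2 <= fheight z + k)%N -> x \in fresidue z.
  case/(_ n.+2) => x xP; exists x; apply/subsetP => z zA; apply/mchainP/xP => //.
  exact: leq_addl.
elim=> [|k [x xP]].
  exists (base_flag M) => z _; rewrite addn0 => le_z.
  by have := ltn_ord (fheight z); rewrite ltnNge le_z.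
case: (pickP [pred z in A | n.+2 == fheight z + k.+1]%N) => [z /andP[/= zA /eqP hz]|noz];
  last first.
  exists x => z zA; rewrite leq_eqVlt => /predU1P[Ez|]; last first.
    by rewrite addnS ltnS; apply: xP.
  by have := noz z; rewrite /= zA (introT eqP Ez).
have onlyz z' : z' \in A -> (n.+2 <= fheight z' + k.+1)%N -> z' = z \/ (fheight z < fheight z')%N.
  move=> zA' hz'; have [Eh|neq_h] := eqVneq (fheight z') (fheight z).
    by left; apply: eq_height.
  by right; rewrite ltn_neqAle eq_sym neq_h /=; lia.
case: (pickP [pred w in A | fheight z < fheight w]%N) => [w0 w0P|now]; last first.
  have [y yz] := face_mk z; exists y => z' zA' /(onlyz z' zA')[-> //|lt_z].
  by have := now z'; rewrite /= zA' lt_z.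
case: (arg_minnP (fun w => nat_of_ord (fheight w)) w0P) => w /andP[wA lt_zw] minw.
have le_zw : face_le z w.
  case/orP: (chA z w zA wA) => // /andP[le_wz _].
  by have := leq_ltn_trans le_wz lt_zw; rewrite ltnn.
have xw : x \in fresidue w by apply: xP => //; lia.
have [v [vb vz vw]] := face_le_below le_zw lt_zw xw.
exists (walk st v x) => z' zA' /(onlyz z' zA')[-> //|lt_z].
have le_w : (fheight w <= fheight z')%N by apply: minw; rewrite /= zA' lt_z.
have xz' : x \in fresidue z' by apply: xP => //; lia.
rewrite (face_in xz') /fresidue /=; apply: walk_residue.
by apply: sub_all vb => i; rewrite /below /off; lia.
Qed.

Lemma mchain_flag x : flag (mchain x).
Proof.
apply/maxsetP; split=> [|B chB sxB]; first exact: mchain_chain.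
have [y sBy] := chain_common chB; apply/esym/eqP.
by rewrite eqEcard sxB (leq_trans (subset_leq_card sBy)) // !mchain_card.
Qed.

Lemma flag_mchain (A : {set face}) : flag A -> exists x, A = mchain x.
Proof.
case/maxsetP => chA maxA; have [x sAx] := chain_common chA; exists x.
by rewrite -(maxA (mchain x)) ?mchain_chain.
Qed.

Lemma mflag_size (A : {set face}) : flag A -> #|A| = n.+2.
Proof. by case/flag_mchain => x ->; apply: mchain_card. Qed.

(** Equal chains make the flags linked off each single letter, hence by [linked_offs] linked without
    any letter. *)
Lemma mchain_inj : injective mchain.
Proof.
move=> x y Exy; apply: (@linked_none _ _ st pred0) => //.
apply: linked_offs => i _.
have hi : (inord i.+1 : 'I_n.+2) = i.+1 :> nat by apply: inordK; have := ltn_ord i; lia.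
have : mk_face (inord i.+1) x \in mchain y by rewrite -Exy mem_mchain.
case/imsetP => h _ Eh; have Ehi : inord i.+1 = h := congr1 fheight Eh.
by move/eqP: Eh; rewrite -Ehi mk_face_eq hi.
Qed.

Lemma height_face z : height z = fheight z.
Proof.
have [x xz] := face_mk z; have zx : z \in mchain x by apply/mchainP.
rewrite (height_flag mflag_size (mchain_flag x) zx) (face_in xz).
set h := fheight z.
have leh : (h <= n.+2)%N by apply: ltnW.
have -> : [set y in mchain x | (y < mk_face h x)%O] =
   [set mk_face (widen_ord leh k) x | k : 'I_h].
  apply/setP => y; rewrite inE; apply/andP/imsetP => [[/imsetP[k _ ->]]|[k _ ->]].
    rewrite lt_leAnge !mk_face_le -ltnNge => /andP[_ kh].
    by exists (Ordinal kh) => //; congr mk_face; apply: val_inj.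
  by rewrite mem_mchain lt_leAnge !mk_face_le -ltnNge /= ltn_ord ltnW.
rewrite card_imset ?card_ord // => k k' /mk_face_inj /(congr1 val) /= Ek.
exact: val_inj.
Qed.

Lemma mchain_face_at x h : face_at (mchain x) h = mk_face h x.
Proof.
have zx := mem_mchain h x.
by have := face_at_height mflag_size (mchain_flag x) zx; rewrite height_face.
Qed.

(** Otherwise path intersection with the single letter [i] would give [x = st i x], against the
    colours. *)
Lemma step_neq_residue (i : 'I_n) x : ~~ linked st (off i.+1) x (st i x).
Proof.
apply/negP => off_i.
have on_i : linked st (pred1 i) x (st i x).
  by apply: (@linked_walk _ _ _ _ [:: i]); rewrite /= eqxx.
have Ex : x = st i x.
  apply: linked_none (step_intersection off_i on_i) => j.
  by rewrite /= /off eqSS; apply/negbTE; rewrite negb_and negbK;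
    case: (eqVneq j i) => [-> | _]; rewrite ?eqxx ?orbT.
by have := colour_step i x; rewrite -Ex; case: colour.
Qed.

Lemma mchain_adjacent (i : 'I_n) x : i_adjacent i (mchain x) (mchain (st i x)).
Proof.
apply/(i_adjacentP mflag_size) => //; split; try exact: mchain_flag.
move=> h lt_h; have := mchain_face_at x (Ordinal lt_h) => /= ->.
have := mchain_face_at (st i x) (Ordinal lt_h) => /= ->.
rewrite mk_face_eq /=; have [->|neq_h] := eqVneq h i.+1.
  by apply/negbTE; exact: step_neq_residue.
by apply: (@linked_walk _ _ _ _ [:: i]); rewrite /= /off eq_sym neq_h.
Qed.

(** By [linked_offs] a walk joins the two flags using only letters at whose heights they differ;
    such letters keep every common face. *)
Lemma face_connected : strongly_flag_connected n face.
Proof.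
move=> _ _ /flag_mchain[x ->] /flag_mchain[y ->].
set D := mchain x :&: mchain y.
pose I : pred 'I_n := fun i => mk_face (inord i.+1) x != mk_face (inord i.+1) y.
have hi (i : 'I_n) : (inord i.+1 : 'I_n.+2) = i.+1 :> nat.
  by apply: inordK; have := ltn_ord i; lia.
have /linkedP[w Iw <-] : linked st I x y.
  by apply: linked_offs => i; rewrite negbK mk_face_eq hi.
have D_sub u : all I u -> D \subset mchain (walk st u x).
  move=> Iu; apply/subsetP => z /setIP[/imsetP[h _ ->] /imsetP[h' _ Eh]].
  have Ehh : h = h' by have := congr1 fheight Eh.
  apply/mchainP; rewrite /fresidue /=; apply: walk_residue.
  apply: sub_all Iu => i; apply: contraNneq => ihE.
  suff -> : inord i.+1 = h by rewrite Eh -Ehh.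
  by apply: val_inj; rewrite /= hi.
elim: w Iw => [|i w IHw] /=; first by rewrite connect0.
move=> /andP[Ii Iw]; apply: connect_trans (IHw Iw) (connect1 _).
rewrite /= D_sub // (D_sub (i :: w)) /= ?Ii //.
by apply/existsP; exists i; apply: mchain_adjacent.
Qed.

(** Flags through [z] and [w] are reached from [x] by letter [i] and letters far from it. These
    commute, so only the parity of the uses of [i] affects the middle face, which is that of [x] or
    of [st i x]. *)
Lemma face_diamond : diamond face.
Proof.
move=> z w zw; rewrite !height_face => hzw.
have le_zw : face_le z w by rewrite -face_leE ltW.
have /andP[_ /existsP[x /andP[xz xw]]] := le_zw.
have ltin : (fheight z < n)%N by have := ltn_ord (fheight w); rewrite hzw; lia.
pose i := Ordinal ltin.
have lth : ((fheight z).+1 < n.+2)%N by lia.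
pose h := Ordinal lth.
have between y : y \in fresidue z -> y \in fresidue w -> (z < mk_face h y < w)%O.
  move=> yz yw; rewrite {1}(face_in yz) {1}(face_in yw) !lt_leAnge !mk_face_le /= hzw.
  by lia.
have neq : mk_face h x != mk_face h (st i x).
  by rewrite mk_face_eq; exact: (step_neq_residue i).
suff -> : [set v | (z < v < w)%O] = [set mk_face h x; mk_face h (st i x)].
  by rewrite cards2 neq.
apply/setP => v; rewrite !inE; apply/idP/orP; last first.
  case=> /eqP->; apply: between => //.
    rewrite (face_in xz) /fresidue /=; apply: (@walk_residue _ [:: i]).
    by rewrite /= /off /=; lia.
  rewrite (face_in xw) /fresidue /=; apply: (@walk_residue _ [:: i]).
  by rewrite /= /off /= hzw; lia.
case/andP => zv vw.
have hv : fheight v = h.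
  apply: val_inj => /=; have := height_lt mflag_size zv; have := height_lt mflag_size vw.
  by rewrite !height_face hzw; lia.
have [y /subsetP sy] : exists y, [set z; v; w] \subset mchain y.
  apply: chain_common; apply/chainP => a b; rewrite !inE.
  move=> /orP[/orP[]|] /eqP-> /orP[/orP[]|] /eqP->;
    rewrite ?comparablexx ?(lt_comparable zv) ?(lt_comparable vw)
      ?(lt_comparable zw) ?(gt_comparable zv) ?(gt_comparable vw)
      ?(gt_comparable zw) //.
have [yz yv yw] : [/\ y \in fresidue z, y \in fresidue v & y \in fresidue w].
  by split; apply/mchainP/sy; rewrite !inE eqxx ?orbT.
have /linkedP[u hu uE] : linked st (predI (off (fheight z)) (off (fheight w))) x y.
  by apply: step_intersection; rewrite -mk_face_eq -!face_in.
pose far : pred 'I_n := fun j => (i.+1 < j)%N || (j.+1 < i)%N.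
have [b far_b] : exists b : bool, linked st far (if b then st i x else x) y.
  rewrite -{}uE; elim: u hu => [|j u IHu] /=; first by exists false; apply: linked_refl.
  move=> /andP[/andP[jz jw] /IHu[b far_b]].
  have [Ej|neq_ji] := eqVneq j i.
    exists (~~ b); have /linkedP[a fa aE] := far_b; apply/linkedP; exists a => //.
    rewrite Ej -aE (walk_far (@stepC n M)) //.
    by case: (b); rewrite //= stepK.
  exists b; apply: linked_trans far_b _.
  apply: (@linked_walk _ _ _ _ [:: j]); rewrite /= andbT /far /=.
  have : j != i :> nat by rewrite (inj_eq val_inj).
  by move: jz jw; rewrite /off hzw /=; lia.
have : linked st (off h) (if b then st i x else x) y.
  by apply: linked_sub far_b => j; rewrite /far /off /=; lia.
rewrite -mk_face_eq => /eqP Ey; rewrite (face_in yv) hv -Ey.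
by case: (b); [right | left].
Qed.

Lemma face_polytope : is_polytope n face.
Proof.
split; [exact: mflag_size | exact: face_connected | exact: face_diamond].
Qed.

End FacePoset.

(** * Chirality or direct regularity, according to how automorphisms act on the colours *)

Section ChiralOrRegular.
Variables (n : nat) (d : Order.disp_t) (T : finTBPOrderType d).
Hypotheses (n_gt1 : (1 < n)%N) (polyT : is_polytope n T).
Variable c : flag_of T -> bool.
Hypothesis cr : forall (i : 'I_n) x, c (adj i x) = ~~ c x.
Variables (s : nat -> {perm T}) (x0 : flag_of T).
Hypothesis s_aut : forall j, (0 < j < n)%N -> s j \in autgrp T.
Hypothesis s_rot : forall i j : 'I_n, i.+1 = j ->
  flag_act (s j) x0 = adj i (adj j x0).

Let n_gt0 : (0 < n)%N. Proof. exact: ltnW. Qed.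

(** Flags coloured unlike [x0] are carried to the other class by one fixed letter, which commutes
    with automorphisms. *)
Lemma colour_trans x y : c x = c y ->
  exists2 g, g \in rot_group n s & flag_act g x = y.
Proof.
have rot_aut := subsetP (rot_group_aut s_aut).
wlog cx : x y / c x = c x0 => [IH cxy|cxy].
  have [cx|neq_c] := eqVneq (c x) (c x0); first exact: IH.
  pose i0 := Ordinal n_gt0.
  have [||g gR gE] := IH (adj i0 x) (adj i0 y).
  - by rewrite cr; case: (c x) (c x0) neq_c => [] [].
  - by rewrite !cr cxy.
  exists g => //; apply: (can_inj (adjK polyT i0)).
  by rewrite -(flag_act_adj polyT) // rot_aut.
have [g gR <-] := rot_group_trans polyT cr s_aut s_rot cx.
have [h hR <-] := rot_group_trans polyT cr s_aut s_rot (etrans (esym cxy) cx).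
exists (g^-1 * h); first by rewrite groupM ?groupV.
rewrite (flag_actM polyT) ?groupV ?rot_aut //.
by rewrite (flag_actK polyT) ?rot_aut.
Qed.

Lemma chiral_of_colour :
  (forall g, g \in autgrp T -> c (flag_act g x0) = c x0) -> chiral n T.
Proof.
move=> c_aut; have rot_aut := subsetP (rot_group_aut s_aut).
have orbE (x y : flag_of T) :
    (val y \in orbit ('P^*)%act (autgrp T) (val x)) = (c x == c y).
  apply/orbitP/eqP => [[g autg gE]|/colour_trans[g gR <-]].
    have <- : flag_act g x = y by apply: val_inj; rewrite (val_flag_act polyT).
    apply/esym/eqP; rewrite (colour_act polyT cr x x0 autg).
    by rewrite c_aut.
  exists g; first exact: rot_aut.
  by rewrite (val_flag_act polyT) // rot_aut.
have orb_eq (x y : flag_of T) : (orbit ('P^*)%act (autgrp T) (val y)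
    == orbit ('P^*)%act (autgrp T) (val x)) = (c x == c y).
  by rewrite -orbE orbit_eq_mem.
pose i0 := Ordinal n_gt0; split.
  suff -> : orbit ('P^*)%act (autgrp T) @: flags T =
    [set orbit ('P^*)%act (autgrp T) (val x0);
         orbit ('P^*)%act (autgrp T) (val (adj i0 x0))].
    by rewrite cards2 orb_eq cr; case: (c x0).
  apply/setP => B; rewrite !inE; apply/imsetP/idP => [[A]|].
    rewrite inE => flA ->; pose x : flag_of T := exist _ A flA.
    rewrite -[A]/(val x) !orb_eq cr; by case: (c x0) (c x) => [] [].
  by case/orP => /eqP->; [exists (val x0) | exists (val (adj i0 x0))];
    rewrite // inE; apply: valP.
move=> i A B adjAB; have [flA flB] : flag A /\ flag B by case/and4P: adjAB.
pose x : flag_of T := exist _ A flA; pose y : flag_of T := exist _ B flB.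
have Ey : adj i x = y by apply: (adj_uniq polyT).
by rewrite -[A]/(val x) -[B]/(val y) orbE -Ey cr; case: (c x).
Qed.

(** Rotations combined with the colour-changing [g0] reach every flag, which provides the
    reflections; the automorphisms that are not rotations form the coset of [g0], whence index
    two. *)
Lemma directly_regular_of_colour g0 : g0 \in autgrp T ->
    c (flag_act g0 x0) != c x0 ->
  directly_regular n T /\ regular_rotations n (val x0) s.
Proof.
move=> autg0 cg0; have rot_aut := subsetP (rot_group_aut s_aut).
have transT x y : exists2 g, g \in autgrp T & flag_act g x = y.
  have [/colour_trans[g gR gE]|neq_c] := eqVneq (c x) (c y).
    by exists g => //; apply: rot_aut.
  have cgx : c (flag_act g0 x) = c y.
    move: cg0; rewrite (colour_act polyT cr x0 x autg0).
    by move: neq_c; case: (c x) (c y) (c (flag_act g0 x)) => [] [] [].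
  have [h hR hE] := colour_trans cgx.
  exists (g0 * h); first by rewrite groupM // rot_aut.
  by rewrite (flag_actM polyT) // rot_aut.
pose rho (i : nat) : {perm T} := if insub i is Some k then
  odflt 1 [pick g in autgrp T | flag_act g x0 == @adj n d T k x0] else 1.
have rhoP (i : 'I_n) : rho i \in autgrp T /\ flag_act (rho i) x0 = adj i x0.
  rewrite /rho valK; case: pickP => [g /andP[autg /eqP //]|nog].
  have [g autg gE] := transT x0 (adj i x0).
  by have := nog g; rewrite autg gE eqxx.
have refl_rho : reflections n (val x0) rho.
  move=> i ltin; have [auti acti] := rhoP (Ordinal ltin).
  by split=> //; rewrite -(val_flag_act polyT) // acti; exact: (adjP polyT (Ordinal ltin)).
(* Both groups consist of the automorphisms that keep the colour of [x0]. *)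
have rotE : rot_group n (rot_of rho) = rot_group n s.
  apply/setP => g; rewrite (mem_rot_group polyT cr s_aut s_rot).
  by rewrite (mem_rot_group polyT cr (rot_of_aut refl_rho) (rot_of_act polyT refl_rho)).
have memR := mem_rot_group polyT cr s_aut s_rot.
split; last first.
  exists rho => // j jn; have ltjn : (j < n)%N by lia.
  have ltin : (j.-1 < n)%N by lia.
  have ij : (Ordinal ltin).+1 = Ordinal ltjn by rewrite /=; lia.
  apply: (flag_act_inj polyT (x := x0)); rewrite ?s_aut ?(rot_of_aut refl_rho) //.
  by rewrite (s_rot ij) (rot_of_act polyT refl_rho ij).
split.
  apply/imsetP; exists (val x0); first by rewrite inE (valP x0).
  apply/setP => A; rewrite inE; apply/idP/orbitP => [flA|[g autg <-]].
    have [g autg gE] := transT x0 (exist _ A flA : flag_of T); exists g => //.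
    by rewrite /= -[A]/(val (exist _ A flA : flag_of T)) -gE (val_flag_act polyT).
  have flx : flag (val (flag_act g x0)) := valP _.
  by move: flx; rewrite (val_flag_act polyT).
exists (val x0), rho; split=> //; first exact: valP.
rewrite rotE; have Ecos : autgrp T :\: rot_group n s = rot_group n s :* g0.
  apply/setP => g; rewrite mem_rcoset in_setD andbC.
  case autg: (g \in autgrp T) => /=; last first.
    apply/esym/negbTE; apply: contraFN autg => /rot_aut autg.
    by rewrite -(mulgKV g0 g) groupM.
  rewrite !memR autg groupM ?groupV //= (flag_actM polyT) ?groupV //.
  have cV : (c (flag_act g0^-1 (flag_act g x0)) == c (flag_act g x0)) = false.
    rewrite (colour_act polyT cr _ (flag_act g0 x0)) ?groupV //.
    by rewrite (flag_actK polyT) // eq_sym; apply/negbTE.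
  by move: cV; case: (c (flag_act g0^-1 _)) (c (flag_act g x0)) (c x0) => [] [] [].
have sub : rot_group n s \subset autgrp T by apply/subsetP.
have := cardsID (rot_group n s) (autgrp T); rewrite Ecos card_rcoset (setIidPr sub).
move=> Ecard; apply/eqP; rewrite -(eqn_pmul2l (cardG_gt0 (rot_group_group n s))).
by rewrite Lagrange // -Ecard addnn muln2.
Qed.

End ChiralOrRegular.

(** The action maps the abstract group to automorphisms, while [polytope_of] asks for an isomorphism
    in the opposite direction. *)
Lemma isom_on_gens_inv n (gT hT : finGroupType) (G : {group gT})
    (f : {morphism G >-> hT}) s u : 'injm f -> G :=: rot_group n s ->
    (forall j, (0 < j < n)%N -> f (s j) = u j) ->
  isom_on_gens n (f @* G) u s.
Proof.
move=> injf EG fs; exists (invm_morphism injf).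
  by apply/isomP; split; [exact: injm_invm | exact: etrans (im_invm injf) EG].
move=> j jn; rewrite -fs // /= invmE // EG.
have ltjn : (j < n)%N by lia.
by apply/mem_gen/imsetP; exists (Ordinal ltjn); rewrite // inE /=; lia.
Qed.

(** * From a group acting on a maniplex to automorphisms of its face poset *)

Section LiftedAction.
Variables (n : nat) (M : maniplex n) (gT : finGroupType) (G : {group gT}).
Variable act : gT -> M -> M.
Hypothesis act_step : forall g i x, g \in G -> act g (step i x) = step i (act g x).
Hypothesis act1 : forall x, act 1 x = x.
Hypothesis actM : forall g h x, g \in G -> h \in G -> act (g * h) x = act h (act g x).
Implicit Types (x y : M) (z : face M).

Definition face_act g z : face M :=
  if [pick x in fresidue z] is Some x then mk_face (fheight z) (act g x) else z.

Lemma face_act_mk g (h : 'I_n.+2) x : g \in G ->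
  face_act g (mk_face h x) = mk_face h (act g x).
Proof.
move=> Gg; rewrite /face_act; case: pickP => [y|/(_ x)]; last by rewrite /= mem_mk_face.
rewrite inE => /linkedP[w hw <-]; apply/eqP; rewrite eq_sym mk_face_eq.
apply/linkedP; exists w => //; elim: w {hw} => //= i w IHw.
by rewrite act_step // IHw.
Qed.

Lemma face_actM g g' z : g \in G -> g' \in G ->
  face_act (g * g') z = face_act g' (face_act g z).
Proof.
move=> Gg Gg'; have [x /face_in->] := face_mk z.
by rewrite !face_act_mk ?groupM // actM.
Qed.

Lemma face_actK g z : g \in G -> face_act g^-1 (face_act g z) = z.
Proof.
move=> Gg; rewrite -face_actM ?groupV // mulgV.
by have [x /face_in->] := face_mk z; rewrite face_act_mk ?group1 // act1.
Qed.

(** Injectivity of [face_act g] is available for [g] in [G], so the permutation is picked among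
    those agreeing with [face_act g], with default 1. *)
Lemma face_perm_ex : {l : gT -> {perm face M} | {in G, forall g, l g =1 face_act g}}.
Proof.
exists (fun g => odflt 1 [pick p : {perm face M} | [forall z, p z == face_act g z]]).
move=> g Gg z; case: pickP => [p /forallP/(_ z)/eqP //|nop].
have inj : injective (face_act g).
  by apply: (can_inj (g := face_act g^-1)) => z'; apply: face_actK.
by have /forallP[] := nop (perm inj) => z'; rewrite permE.
Qed.

Definition face_perm := sval face_perm_ex.

Lemma face_permE g z : g \in G -> face_perm g z = face_act g z.
Proof. by move=> Gg; apply: (svalP face_perm_ex). Qed.

Lemma face_act_le g z z' : g \in G -> (z <= z')%O -> (face_act g z <= face_act g z')%O.
Proof.
move=> Gg; rewrite face_leE => /andP[le_h /existsP[x /andP[/face_in Ez /face_in Ez']]].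
by rewrite Ez Ez' !face_act_mk // mk_face_le.
Qed.

Lemma face_perm_aut g : g \in G -> face_perm g \in autgrp (face M).
Proof.
move=> Gg; rewrite inE; apply/forallP => z; apply/forallP => z'.
rewrite !face_permE //; apply/eqP; apply/idP/idP; last exact: face_act_le.
by move/(@face_act_le g^-1); rewrite groupV !face_actK // => ->.
Qed.

Definition mface_flag x : flag_of (face M) := exist _ (mchain x) (mchain_flag x).

Lemma mface_flag_surj (y : flag_of (face M)) : exists x, y = mface_flag x.
Proof.
by have [x Ex] := flag_mchain (valP y); exists x; apply: val_inj.
Qed.

Lemma mface_flag_inj : injective mface_flag.
Proof. by move=> x y /(congr1 val)/mchain_inj. Qed.

Lemma adj_mface_flag i x : adj i (mface_flag x) = mface_flag (step i x).
Proof. by apply: (adj_uniq (face_polytope M)); apply: mchain_adjacent. Qed.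

Lemma face_perm_act g x : g \in G ->
  flag_act (face_perm g) (mface_flag x) = mface_flag (act g x).
Proof.
move=> Gg; apply: val_inj.
rewrite (val_flag_act (face_polytope M)) ?face_perm_aut //= /mchain -imset_comp.
by apply: eq_imset => h; rewrite /= face_permE // face_act_mk.
Qed.

Lemma face_permM : {in G &, {morph face_perm : g h / g * h}}.
Proof.
move=> g h Gg Gh; apply/permP => z; rewrite permM (face_permE _ (groupM Gg Gh)).
by rewrite (face_permE _ Gg) (face_permE _ Gh) face_actM.
Qed.

Canonical face_perm_morphism := Morphism face_permM.

Definition mcolour (y : flag_of (face M)) :=
  [exists x, (mface_flag x == y) && colour x].

Lemma mcolourE x : mcolour (mface_flag x) = colour x.
Proof.
apply/existsP/idP => [[y /andP[/eqP/mface_flag_inj-> //]]|cx].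
by exists x; rewrite eqxx.
Qed.

Lemma mcolour_adj (i : 'I_n) (y : flag_of (face M)) : mcolour (adj i y) = ~~ mcolour y.
Proof.
by have [x ->] := mface_flag_surj y; rewrite adj_mface_flag !mcolourE colour_step.
Qed.

Variable s : nat -> gT.
Hypothesis n_gt1 : (1 < n)%N.
Hypothesis Grot : G :=: rot_group n s.
Hypothesis act_rot : forall i j : 'I_n, i.+1 = j ->
  act (s j) (base_flag M) = step i (step j (base_flag M)).
Hypothesis act_free : forall g, g \in G -> act g (base_flag M) = base_flag M -> g = 1.

(** [G] acts faithfully on the face poset as its rotation group; the two alternatives of
    [polytope_of] correspond to whether some automorphism exchanges the colours. *)
Lemma maniplex_polytope_of :
  exists u, polytope_of n s (mchain (base_flag M)) u.
Proof.
exists (face_perm \o s).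
set x0 := mface_flag (base_flag M); have polyM := face_polytope M.
have sG j : (0 < j < n)%N -> s j \in G.
  move=> jn; rewrite Grot; have ltjn : (j < n)%N by lia.
  by apply/mem_gen/imsetP; exists (Ordinal ltjn); rewrite // inE /=; lia.
have u_aut j : (0 < j < n)%N -> (face_perm \o s) j \in autgrp (face M).
  by move=> /sG /face_perm_aut.
have u_rot (i j : 'I_n) : i.+1 = j -> flag_act ((face_perm \o s) j) x0 = adj i (adj j x0).
  move=> ij; rewrite /= face_perm_act; last by apply: sG; have := ltn_ord j; lia.
  by rewrite (act_rot ij) !adj_mface_flag.
have inj_perm : 'injm face_perm.
  apply/subsetP => g /morphpreP[Gg /set1P g1]; apply/set1P/act_free => //.
  by apply: mface_flag_inj; rewrite -face_perm_act // g1 (flag_act1 polyM).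
have perm_im : face_perm @* G = rot_group n (face_perm \o s).
  rewrite {2}Grot /rot_group morphim_gen; last first.
    rewrite Grot; exact: subset_gen.
  congr <<_>>; rewrite morphimEsub; last by rewrite Grot; exact: subset_gen.
  by rewrite -imset_comp.
have isoR : isom_on_gens n (rot_group n (face_perm \o s)) (face_perm \o s) s.
  by rewrite -perm_im; apply: (isom_on_gens_inv inj_perm Grot).
split; [exact: polyM | exact: mchain_flag |].
case: (pickP [pred g in autgrp (face M) | mcolour (flag_act g x0) != mcolour x0]).
  move=> g0 /andP[/= autg0 cg0]; right.
  have [dreg rots] := directly_regular_of_colour n_gt1 polyM mcolour_adj u_aut u_rot autg0 cg0.
  by split.
move=> no_g; have c_aut g : g \in autgrp (face M) -> mcolour (flag_act g x0) = mcolour x0.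
  by move=> autg; have := no_g g; rewrite /= autg => /negbFE/eqP.
left; split.
- exact: (chiral_of_colour n_gt1 polyM mcolour_adj u_aut u_rot c_aut).
- move=> j jn; split; first exact: u_aut.
  have ltjn : (j < n)%N by lia. have ltin : (j.-1 < n)%N by lia.
  exists (val (adj (Ordinal ltjn) x0)); first exact: (adjP polyM (Ordinal ltjn) x0).
  rewrite -[mchain _]/(val x0) -(val_flag_act polyM) ?u_aut //.
  have ij : (Ordinal ltin).+1 = Ordinal ltjn by rewrite /=; lia.
  have := u_rot _ _ ij => /= ->; exact: (adjP polyM (Ordinal ltin)).
- suff -> : autgrp (face M) = rot_group n (face_perm \o s) by [].
  apply/setP => g; rewrite (mem_rot_group polyM mcolour_adj u_aut u_rot).
  by case autg: (g \in autgrp _) => //=; rewrite c_aut ?eqxx.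
Qed.

End LiftedAction.

(** * The mix of two rotation groups *)

Lemma mem_rot_gen n (gT : finGroupType) (s : nat -> gT) j :
  (0 < j < n)%N -> s j \in rot_group n s.
Proof.
move=> jn; have ltjn : (j < n)%N by lia.
by apply/mem_gen/imsetP; exists (Ordinal ltjn); rewrite // inE /=; lia.
Qed.

Lemma rot_group_sub n (gT : finGroupType) (s : nat -> gT) (K : {group gT}) :
  (forall j, (0 < j < n)%N -> s j \in K) -> rot_group n s \subset K.
Proof.
move=> sK; rewrite gen_subG; apply/subsetP => g /imsetP[j]; rewrite inE => j0 ->.
by apply: sK; rewrite j0 ltn_ord.
Qed.

Lemma expg_congr (gT : finGroupType) (x : gT) m k :
  m = k %[mod #[x]] -> x ^+ m = x ^+ k.
Proof. by move=> Emk; rewrite -expg_mod_order Emk expg_mod_order. Qed.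

Lemma expg_pair (gT hT : finGroupType) (x : gT) (y : hT) m :
  (x, y) ^+ m = (x ^+ m, y ^+ m).
Proof. by elim: m => [|m IHm]; rewrite ?expg0 // !expgS IHm. Qed.

Lemma order_pair (gT hT : finGroupType) (x : gT) (y : hT) :
  coprime #[x] #[y] -> #[(x, y)] = (#[x] * #[y])%N.
Proof.
move=> co_xy.
have ox : #[pairg1 hT x] = #[x] by rewrite order_injm ?injm_pairg1 ?inE.
have oy : #[pair1g gT y] = #[y] by rewrite order_injm ?injm_pair1g ?inE.
have -> : (x, y) = pairg1 hT x * pair1g gT y.
  by rewrite /pairg1 /pair1g; congr pair; rewrite /= ?mulg1 ?mul1g.
rewrite orderM ?ox ?oy //.
by rewrite /commute /pairg1 /pair1g; congr pair; rewrite /= ?mulg1 ?mul1g.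
Qed.

(** By the Chinese remainder theorem, one power of [(s j, t j)] is [(s j, 1)] and another is
    [(1, t j)]. *)
Lemma mix_setX n (gT hT : finGroupType) (s : nat -> gT) (t : nat -> hT) :
  (forall j, (0 < j < n)%N -> coprime #[s j] #[t j]) ->
  mix n s t = setX (rot_group n s) (rot_group n t).
Proof.
move=> co_st; apply/eqP; rewrite eqEsubset; apply/andP; split.
  apply: (@rot_group_sub _ _ _ (setX_group _ _)) => j jn.
  by rewrite inE !mem_rot_gen.
have mixX j m : (0 < j < n)%N -> (s j ^+ m, t j ^+ m) \in mix n s t.
  by move=> jn; rewrite -expg_pair groupX // (@mem_rot_gen _ _ (mix_gen s t)).
have sub1 : rot_group n s \subset pairg1 hT @*^-1 (mix n s t).
  apply: rot_group_sub => j jn; rewrite !inE /= /pairg1.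
  have := mixX j (chinese #[s j] #[t j] 1 0) jn.
  rewrite (expg_congr (chinese_modl (co_st j jn) 1 0)).
  by rewrite (expg_congr (chinese_modr (co_st j jn) 1 0)) expg0 expg1.
have sub2 : rot_group n t \subset @pair1g gT hT @*^-1 (mix n s t).
  apply: rot_group_sub => j jn; rewrite !inE /= /pair1g.
  have := mixX j (chinese #[s j] #[t j] 0 1) jn.
  rewrite (expg_congr (chinese_modl (co_st j jn) 0 1)).
  by rewrite (expg_congr (chinese_modr (co_st j jn) 0 1)) expg0 expg1.
apply/subsetP => -[x y]; rewrite inE /= => /andP[/(subsetP sub1) + /(subsetP sub2)].
rewrite !inE /= /pairg1 /pair1g => x1 y1.
have -> : (x, y) = (x, 1) * (1, y) by congr pair; rewrite /= ?mulg1 ?mul1g.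
exact: groupM.
Qed.

(* |H / N| = |K|^2 divides |K| |L|. *)
Lemma no_square_quotient (gT hT : finGroupType) (K : {group gT}) (L : {group hT}) :
  ~~ (#|K| %| #|L|)%N -> no_subgroup_with_quotient (setX K L) (setX K K).
Proof.
move=> ndiv H N sHG nNH /card_isog; rewrite card_quotient ?normal_norm //.
rewrite cardsX => EHN; move/negP: ndiv; apply.
rewrite -(dvdn_pmul2l (cardG_gt0 K)) -EHN -cardsX.
apply: dvdn_trans (dvdn_indexg _ _) _.
exact: (@cardSg _ (setX_group K L) H).
Qed.

(** * Totally chiral polytopes *)

Section TotallyChiral.
Variables (n : nat) (d : Order.disp_t) (R : finTBPOrderType d).
Hypotheses (n_gt0 : (0 < n)%N) (polyR : is_polytope n R).
Variables (x0 : flag_of R) (rho : nat -> {perm R}).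
Hypothesis refl_rho : reflections n (val x0) rho.

Definition word_val (w : seq 'I_n) : {perm R} := \prod_(i <- w) rho i.

Lemma word_val_cat w1 w2 : word_val (w1 ++ w2) = word_val w1 * word_val w2.
Proof. exact: big_cat. Qed.

(** The reflections satisfy the Coxeter relations, so [word_val] descends to [cox n] and yields the
    homomorphism [cox_val]. *)
Lemma word_val_eq w1 w2 : cox_eq w1 w2 -> word_val w1 = word_val w2.
Proof.
have val2 (i j : 'I_n) : word_val [:: i; j] = rho i * rho j.
  by rewrite /word_val !big_cons big_nil mulg1.
elim=> [//|u v _ -> //|u v w _ -> _ -> //|u v i|u v i j far_ij].
  by rewrite !word_val_cat val2 (reflection_sq polyR refl_rho) mul1g.
rewrite -[[:: i; j; i; j]]/([:: i; j] ++ [:: i; j]) !word_val_cat !val2.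
by rewrite (reflection_far polyR refl_rho far_ij) mul1g.
Qed.

Definition cox_val (x : cox n) : {perm R} := word_val (generic_quotient.repr x).

Lemma cox_val_word w : cox_val (cox_word w) = word_val w.
Proof. exact/word_val_eq/cox_repr. Qed.

Lemma cox_valM x y : cox_val (x * y) = cox_val x * cox_val y.
Proof. by rewrite -word_val_cat -cox_val_word. Qed.

Lemma cox_val1 : cox_val 1 = 1.
Proof. by apply: (@mulgI _ (cox_val 1)); rewrite -cox_valM !mulg1. Qed.

Lemma cox_valV x : cox_val x^-1 = (cox_val x)^-1.
Proof.
by apply: (@mulgI _ (cox_val x)); rewrite -cox_valM !mulgV cox_val1.
Qed.

Lemma cox_val_r i : (i < n)%N -> cox_val (cox_r n i) = rho i.
Proof.
move=> ltin; rewrite /cox_r insubT cox_val_word /word_val.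
by rewrite big_cons big_nil mulg1.
Qed.

Variables (gT hT : finGroupType) (s : nat -> gT) (t : nat -> hT).
Variable u : nat -> {perm R}.
Hypothesis u_rho : forall j, (0 < j < n)%N -> u j = rot_of rho j.
Local Notation H := (rot_group n u).
Variable f : {morphism H >-> gT * hT}.
Hypothesis f_isom : isom H (rot_group n (mix_gen s t)) f.
Hypothesis f_gens : forall j, (0 < j < n)%N -> f (u j) = mix_gen s t j.

Let rho_sq i : (i < n)%N -> rho i * rho i = 1.
Proof. by move=> ltin; apply: (reflection_sq polyR refl_rho (Ordinal ltin)). Qed.

Lemma rho0_mul k : (k < n)%N -> rho 0 * rho k \in H.
Proof.
elim: k => [|k IHk] ltkn; first by rewrite rho_sq.
rewrite -(mulgKV (rho k) (rho 0)) -mulgA.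
have -> : (rho k)^-1 = rho k.
  by apply: (@mulgI _ (rho k)); rewrite mulgV rho_sq // ltnW.
rewrite groupM ?IHk ?(ltnW ltkn) //.
by have := u_rho (j := k.+1); rewrite /rot_of /= => <- //; apply: mem_rot_gen.
Qed.

Lemma rho0_norm g : g \in H -> g ^ rho 0 \in H.
Proof.
suff nH : H :^ rho 0 \subset H.
  by move=> gH; apply: (subsetP nH); rewrite memJ_conjg.
rewrite -genJ gen_subG; apply/subsetP => k /imsetP[l /imsetP[j]].
rewrite inE => j0 -> ->; rewrite u_rho ?j0 ?ltn_ord //.
have -> : rot_of rho (val j) ^ rho 0 = (rho 0 * rho j.-1) * (rho 0 * rho j)^-1.
  rewrite /conjg /rot_of invMg.
  have inv i : (i < n)%N -> (rho i)^-1 = rho i.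
    by move=> ltin; apply: (@mulgI _ (rho i)); rewrite mulgV rho_sq.
  by rewrite !inv // !mulgA.
by rewrite groupM ?groupV // rho0_mul //; have := ltn_ord j; lia.
Qed.

Lemma mix_fst : rot_group n s = [set (f g).1 | g in H].
Proof.
apply/eqP; rewrite eqEsubset; apply/andP; split.
  have grpF : group_set [set (f g).1 | g in H].
    apply/group_setP; split.
      by apply/imsetP; exists 1; rewrite ?group1 // morph1.
    move=> _ _ /imsetP[g gH ->] /imsetP[h hH ->].
    by apply/imsetP; exists (g * h); rewrite ?groupM // morphM.
  apply: (@rot_group_sub _ _ _ (Group grpF)) => j jn; apply/imsetP.
  by exists (u j); rewrite ?mem_rot_gen // f_gens.
apply/subsetP => _ /imsetP[g gH ->].
have : f g \in f @* H by rewrite mem_morphim.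
rewrite (isom_im f_isom); move: (f g) => x xmix.
have sub : rot_group n (mix_gen s t) \subset (@fst gT hT) @*^-1 (rot_group n s).
  by apply: rot_group_sub => j jn; rewrite !inE /= mem_rot_gen.
by have := subsetP sub x xmix; rewrite !inE.
Qed.

(** The quotient map sends [f g] to the first coordinates of [f g] and [f (g ^ rho 0)]. Total
    chirality writes each element of [cox_plus] as [m] times a conjugate of [m'] by [cox_r n 0],
    both in the kernel of [phi]; this puts [(a, 1)] and [(1, a)] in the image. *)
Lemma totally_chiral_quotient : totally_chiral n s ->
  exists N : {group gT * hT}, N <| rot_group n (mix_gen s t) /\
    rot_group n (mix_gen s t) / N \isog setX (rot_group n s) (rot_group n s).
Proof.
case=> phi [phiM phi_s phi_tot].
have phi1 : phi 1 = 1.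
  apply: (@mulgI _ (phi 1)); rewrite -phiM ?mulg1 //; exact: gen_by_1.
(* On [cox_plus] the map [phi] is determined by the generators, so it is [cox_val] followed by [f]
   and the first projection. *)
have phi_val w : cox_plus w -> cox_val w \in H /\ phi w = (f (cox_val w)).1.
  elim=> [_ [j jn ->]||x y px [xH xE] py [yH yE]|x px [xH xE]].
  - have -> : cox_val (cox_s n j) = u j.
      by rewrite cox_valM !cox_val_r ?u_rho //; lia.
    by rewrite mem_rot_gen // phi_s // f_gens.
  - by rewrite cox_val1 group1 phi1 morph1.
  - by rewrite cox_valM groupM // phiM // xE yE morphM.
  - rewrite cox_valV groupV xH morphV //; split=> //.
    apply: (@mulgI _ (phi x)); rewrite -phiM //; last exact: gen_by_V.
    by rewrite !mulgV phi1 xE mulgV.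
have phi_surj a : a \in rot_group n s -> exists2 w, cox_plus w & phi w = a.
  case/gen_prodgP => m [c cS ->]; elim: m c cS => [|m IHm] c cS.
    by exists 1; rewrite ?big_ord0 //; apply: gen_by_1.
  have [w pw wE] := IHm (fun i => c (lift ord0 i)) (fun i => cS _).
  have /imsetP[j] := cS ord0; rewrite inE => j0 cj.
  have jn : (0 < j < n)%N by rewrite j0 ltn_ord.
  have pj : cox_plus (cox_s n j) by apply: gen_by_in; exists (j : nat).
  exists (cox_s n j * w); first exact: gen_by_M.
  by rewrite phiM // phi_s // big_ord_recl wE cj.
have injf := isom_inj f_isom; have imf := isom_im f_isom.
pose chi (x : gT * hT) := (x.1, (f (invm injf x ^ rho 0)).1).
have chiE g : g \in H -> chi (f g) = ((f g).1, (f (g ^ rho 0)).1).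
  by move=> gH; rewrite /chi invmE.
have chiM : {in f @* H &, {morph chi : x y / x * y}}.
  move=> _ _ /morphimP[g _ gH ->] /morphimP[h _ hH ->].
  rewrite -morphM // !chiE ?groupM //.
  by rewrite conjMg (morphM f gH hH) (morphM f (rho0_norm gH) (rho0_norm hH)).
pose X := Morphism chiM.
exists ('ker X)%G; rewrite -imf; split; first exact: ker_normal.
suff <- : X @* (f @* H) = setX (rot_group n s) (rot_group n s) by exact: first_isog.
have imX g : g \in H -> ((f g).1, (f (g ^ rho 0)).1) \in X @* (f @* H).
  by move=> gH; rewrite -chiE //; apply: mem_morphim; rewrite mem_morphim.
apply/eqP; rewrite eqEsubset; apply/andP; split.
  apply/subsetP => _ /morphimP[_ _ /morphimP[g _ gH ->] ->] /=.
  have fst_mem k : k \in H -> (f k).1 \in rot_group n s.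
    by move=> kH; rewrite mix_fst; apply/imsetP; exists k.
  by rewrite chiE // inE /= !fst_mem // rho0_norm.
have half a : a \in rot_group n s ->
    (a, 1) \in X @* (f @* H) /\ (1, a) \in X @* (f @* H).
  case/phi_surj => w pw wa.
  have [m [m' [[pm m1] [pm' m'1] wE]]] := (phi_tot w).1 pw.
  (* Here [phi v = a] and [phi m' = 1], while conjugation by [rho 0] exchanges the images of [v] and
     [m']. *)
  set v := cox_r n 0 * m' * (cox_r n 0)^-1 in wE.
  have pv : cox_plus v.
    by rewrite -(mulKg m v) -wE; apply: gen_by_M => //; apply: gen_by_V.
  have va : phi v = a by rewrite -wa wE phiM // m1 mul1g.
  have [vH vE] := phi_val v pv; have [m'H m'E] := phi_val m' pm'.
  have val_v : cox_val v ^ rho 0 = cox_val m'.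
    rewrite /v !cox_valM cox_valV cox_val_r // /conjg.
    by rewrite !mulgA mulVg mul1g mulgKV.
  have val_m' : cox_val m' ^ rho 0 = cox_val v.
    by rewrite -val_v -conjgM rho_sq // conjg1.
  split.
    by have := imX _ vH; rewrite val_v -vE va -m'E m'1.
  by have := imX _ m'H; rewrite val_m' -vE va -m'E m'1.
apply/subsetP => -[a b]; rewrite inE /= => /andP[/half[a1 _] /half[_ b1]].
have -> : (a, b) = (a, 1) * (1, b) by congr pair; rewrite /= ?mulg1 ?mul1g.
exact: groupM.
Qed.

End TotallyChiral.

(** * The mix of a chiral and a directly regular polytope *)

Lemma iter_mod (X : Type) (f : X -> X) q m k x :
  (forall x, iter q f x = x) -> m = k %[mod q] -> iter m f x = iter k f x.
Proof.
move=> fq; have fmod l : iter l f x = iter (l %% q) f x.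
  rewrite {1}(divn_eq l q) addnC iterD; congr iter.
  by elim: (l %/ q) => // a IHa; rewrite mulSn iterD IHa fq.
by move=> Emk; rewrite fmod Emk -fmod.
Qed.

Section MixPolytopes.
Variables (n : nat) (dP dQ : Order.disp_t).
Variables (P : finTBPOrderType dP) (Q : finTBPOrderType dQ).
Hypotheses (n_gt1 : (1 < n)%N) (polyP : is_polytope n P) (polyQ : is_polytope n Q).
Variables (cP : flag_of P -> bool) (cQ : flag_of Q -> bool).
Hypothesis cP_adj : forall (i : 'I_n) x, cP (adj i x) = ~~ cP x.
Hypothesis cQ_adj : forall (i : 'I_n) y, cQ (adj i y) = ~~ cQ y.
Variables (x0 : flag_of P) (y0 : flag_of Q).
Hypothesis c0 : cP x0 = cQ y0.
Variables (s : nat -> {perm P}) (t : nat -> {perm Q}).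
Hypothesis s_aut : forall j, (0 < j < n)%N -> s j \in autgrp P.
Hypothesis s_rot : forall i j : 'I_n, i.+1 = j ->
  flag_act (s j) x0 = adj i (adj j x0).
Hypothesis t_aut : forall j, (0 < j < n)%N -> t j \in autgrp Q.
Hypothesis t_rot : forall i j : 'I_n, i.+1 = j ->
  flag_act (t j) y0 = adj i (adj j y0).
Hypothesis co_st : forall j, (0 < j < n)%N -> coprime #[s j] #[t j].

Lemma mix_coprime_steps (i j : 'I_n) : i.+1 = j -> exists m,
  (forall x : flag_of P, iter m (fun x => adj i (adj j x)) x = x) /\
  (forall y : flag_of Q, iter m (fun y => adj i (adj j y)) y = adj i (adj j y)).
Proof.
move=> ij; have jn : (0 < j < n)%N by have := ltn_ord j; lia.
(* The exponent is 0 modulo the order of [s j] and 1 modulo the order of [t j]. *)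
exists (chinese #[s j] #[t j] 0 1); split=> [x|y].
  apply: (rot_order_walk polyP cP_adj s_aut s_rot x ij).
  by rewrite (expg_congr (chinese_modl (co_st jn) 0 1)).
apply: etrans (iter_mod _ _ (chinese_modr (co_st jn) 0 1)) _ => // z.
apply: (rot_order_walk polyQ cQ_adj t_aut t_rot z ij).
exact: expg_order.
Qed.

Definition mix_base : mix_type cP cQ := exist _ (x0, y0) (introT eqP c0).

Definition mix_maniplex : maniplex n := Maniplex
  (mix_stepK (adjK polyP) (adjK polyQ) cP_adj cQ_adj)
  (mix_stepC (adjC polyP) (adjC polyQ) cP_adj cQ_adj)
  (colour := fun xy => cP (val xy).1)
  (fun i xy => cP_adj i (val xy).1)
  (mix_connected (adjK polyP) (adjK polyQ) (adjC polyQ) mix_coprime_steps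
     cP_adj cQ_adj (adj_connected polyP) (adj_connected polyQ))
  (mix_path_intersection (adjK polyP) (adjK polyQ) (adjC polyP) (adjC polyQ)
     mix_coprime_steps (cr := cP_adj) (c'r := cQ_adj)
     (adj_path_intersection polyP) (adj_path_intersection polyQ))
  mix_base.

Local Notation M := mix_maniplex.
Local Notation G := (rot_group n (mix_gen s t)).

Definition mix_act (g : {perm P} * {perm Q}) (xy : M) : M :=
  insubd xy (flag_act g.1 (val xy).1, flag_act g.2 (val xy).2).

Lemma mem_mix g : g \in G -> (g.1 \in rot_group n s) && (g.2 \in rot_group n t).
Proof. by rewrite -/(mix n s t) mix_setX // inE. Qed.

Lemma mix_aut g : g \in G -> g.1 \in autgrp P /\ g.2 \in autgrp Q.
Proof.
case/mem_mix/andP => /(subsetP (rot_group_aut s_aut)) ?.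
by move/(subsetP (rot_group_aut t_aut)).
Qed.

(** Both components of [g] are rotations and preserve colours, so the image is again a pair of equal
    colours and the default of [insubd] is not taken. *)
Lemma val_mix_act g xy : g \in G ->
  val (mix_act g xy) = (flag_act g.1 (val xy).1, flag_act g.2 (val xy).2).
Proof.
move=> Gg; have [aut1 aut2] := mix_aut Gg; rewrite insubdK // unfold_in /=.
have /andP[] := mem_mix Gg.
rewrite (mem_rot_group polyP cP_adj s_aut s_rot) => /andP[_].
rewrite (colour_act polyP cP_adj x0 (val xy).1 aut1) => /eqP ->.
rewrite (mem_rot_group polyQ cQ_adj t_aut t_rot) => /andP[_].
rewrite (colour_act polyQ cQ_adj y0 (val xy).2 aut2) => /eqP ->.
exact: valP xy.
Qed.

Lemma mix_act_step g i xy : g \in G -> mix_act g (step i xy) = step i (mix_act g xy).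
Proof.
move=> Gg; have [aut1 aut2] := mix_aut Gg.
apply: val_inj; rewrite val_mix_act //= val_mix_act //=.
by rewrite (flag_act_adj polyP) // (flag_act_adj polyQ).
Qed.

Lemma mix_act1 xy : mix_act 1 xy = xy.
Proof.
apply: val_inj; rewrite val_mix_act ?group1 //= (flag_act1 polyP) (flag_act1 polyQ).
by case: (val xy).
Qed.

Lemma mix_actM g h xy : g \in G -> h \in G ->
  mix_act (g * h) xy = mix_act h (mix_act g xy).
Proof.
move=> Gg Gh; have [g1 g2] := mix_aut Gg; have [h1 h2] := mix_aut Gh.
apply: val_inj; rewrite !val_mix_act ?groupM //=.
by rewrite (flag_actM polyP) // (flag_actM polyQ).
Qed.

Lemma mix_act_inj : {in G &, injective (fun g => mix_act g mix_base)}.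
Proof.
move=> g h Gg Gh /(congr1 val); rewrite !val_mix_act // => -[E1 E2].
have [g1 g2] := mix_aut Gg; have [h1 h2] := mix_aut Gh.
rewrite (surjective_pairing g) (surjective_pairing h).
by rewrite (flag_act_inj polyP g1 h1 E1) (flag_act_inj polyQ g2 h2 E2).
Qed.

Lemma mix_act_rot (i j : 'I_n) : i.+1 = j ->
  mix_act (mix_gen s t j) mix_base = step i (step j (mix_base : M)).
Proof.
move=> ij; have Gj : mix_gen s t j \in G.
  by apply: mem_rot_gen; have := ltn_ord j; lia.
apply: val_inj; rewrite val_mix_act //=.
by rewrite (s_rot ij) (t_rot ij).
Qed.

Lemma mix_intersection_property : intersection_property n (mix_gen s t).
Proof.
apply: (@orbit_intersection_property n _ [group of G] _ M (@step n M)
  (fun g => mix_act g mix_base) (@stepK n M) _ _ (@colour n M) (@colour_step n M)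
  (@step_intersection n M) mix_act_inj).
  by move=> j jn; apply: mem_rot_gen.
move=> i j g ij Gg; have Gj : mix_gen s t j \in G.
  by apply: mem_rot_gen; have := ltn_ord j; lia.
by rewrite mix_actM // (mix_act_rot ij) !mix_act_step.
Qed.

Lemma mix_polytope_of :
  exists u, polytope_of n (mix_gen s t) (mchain (base_flag M)) u.
Proof.
apply: (@maniplex_polytope_of n M _ [group of G] mix_act) => //.
- exact: mix_act_step.
- exact: mix_act1.
- exact: mix_actM.
- exact: mix_act_rot.
move=> g Gg gE; apply: mix_act_inj => //.
by rewrite mix_act1.
Qed.

End MixPolytopes.

(** Existence is a separate conjunct; the type and the chirality are asserted for every polytope
    associated with the mix, so that they do not depend on the one constructed. *)
Theorem theorem9p1 (n : nat) (hn : (3 <= n)%N)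
  (dP : Order.disp_t) (P : finTBPOrderType dP)
  (Phi : {set P}) (s : nat -> {perm P}) (p : nat -> nat)
  (dQ : Order.disp_t) (Q : finTBPOrderType dQ)
  (Psi : {set Q}) (t : nat -> {perm Q}) (q : nat -> nat)
  (hP : is_polytope n P) (chiP : chiral n P)
  (hPhi : flag Phi) (hs : chiral_rotations n Phi s)
  (hp : forall j, (0 < j < n)%N -> #[s j] = p j)
  (hQ : is_polytope n Q) (regQ : directly_regular n Q)
  (hPsi : flag Psi) (ht : regular_rotations n Psi t)
  (hq : forall j, (0 < j < n)%N -> #[t j] = q j)
  (hpq : forall j, (0 < j < n)%N -> coprime (p j) (q j)) :
  let G := setX (autgrp P) (rot_group n t) in
  [/\ intersection_property n (mix_gen s t),
      mix n s t = G,
      exists (dR : Order.disp_t) (R : finTBPOrderType dR)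
             (Omega : {set R}) (u : nat -> {perm R}),
        polytope_of n (mix_gen s t) Omega u,
      ~~ (#|autgrp P| %| #|rot_group n t|)%N ->
        no_subgroup_with_quotient G (setX (autgrp P) (autgrp P))
    & forall (dR : Order.disp_t) (R : finTBPOrderType dR)
             (Omega : {set R}) (u : nat -> {perm R}),
        polytope_of n (mix_gen s t) Omega u ->
        (forall j, (0 < j < n)%N -> #[u j] = (p j * q j)%N) /\
        (totally_chiral n s ->
         no_subgroup_with_quotient G (setX (autgrp P) (autgrp P)) ->
         chiral n R)].
Proof.
pose x0 : flag_of P := exist _ Phi hPhi; pose y0 : flag_of Q := exist _ Psi hPsi.
have n_gt1 : (1 < n)%N by lia.
have n_gt0 : (0 < n)%N by lia.
have [cP [cP_adj cx0 cP_aut]] := chiral_colour hP x0 chiP.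
have [cQ [cQ_adj cy0]] := directly_regular_colour hQ y0 n_gt0 regQ.
have [s_aut s_rot] := chiral_rotationsP hP (x0 := x0) hs.
have [rho refl_rho t_rho] := ht.
have t_aut j : (0 < j < n)%N -> t j \in autgrp Q.
  by move=> jn; rewrite t_rho // (rot_of_aut (x0 := y0) refl_rho).
have t_rot (i j : 'I_n) : i.+1 = j -> flag_act (t j) y0 = adj i (adj j y0).
  move=> ij; rewrite t_rho ?(rot_of_act hQ (x0 := y0) refl_rho ij) //.
  by have := ltn_ord j; lia.
have co_st j : (0 < j < n)%N -> coprime #[s j] #[t j].
  by move=> jn; rewrite hp // hq // hpq.
have c0 : cP x0 = cQ y0 by rewrite cx0 cy0.
(* All automorphisms of the chiral [P] keep the colour of [x0], so all are rotations. *)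
have autE : rot_group n s = autgrp P.
  apply/setP => g; rewrite (mem_rot_group hP cP_adj s_aut s_rot).
  by case autg: (g \in autgrp P) => //=; rewrite cx0 cP_aut.
have mixE : mix n s t = setX (autgrp P) (rot_group n t) by rewrite mix_setX ?autE.
split=> //.
- exact: (mix_intersection_property n_gt1 hP hQ cP_adj cQ_adj c0 s_aut s_rot t_aut t_rot co_st).
- do 3![eexists].
  exact: (mix_polytope_of n_gt1 hP hQ cP_adj cQ_adj c0 s_aut s_rot t_aut t_rot co_st).
- exact: (@no_square_quotient _ _ (autgrp_group P) [group of rot_group n t]).
move=> dR R Omega u [polyR flOmega caseR]; split.
  (* In either alternative an injective morphism takes [u j] to [(s j, t j)], whose order is the
     product of two coprime orders. *)
  move=> j jn; rewrite -hp // -hq // -(order_pair (co_st j jn)).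
  case: caseR => [[_ rotu [f /isom_inj injf fu]]|[_ _ [f /isom_inj injf fu]]].
    by rewrite -[(s j, t j)]/(mix_gen s t j) -fu // order_injm //; case: (rotu j jn).
  by rewrite -[(s j, t j)]/(mix_gen s t j) -fu // order_injm // mem_rot_gen.
(* Were [R] directly regular, the whole mix would be a subgroup of [G] with the forbidden
   quotient. *)
move=> totP noquot; case: caseR => [[] //|[_ [rhoR reflR uR] [f f_isom fu]]].
have [N [nN isoN]] := totally_chiral_quotient n_gt0 polyR
  (x0 := exist _ Omega flOmega) reflR uR f_isom fu totP.
case: (noquot [group of rot_group n (mix_gen s t)] N) => //.
  by rewrite -mixE.
by rewrite -autE.
Qed.
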